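(* Let $R$ be a random variable with values in $\{1,2,\dots\}$ such that $\mathbb{E}[R^{1+\varepsilon}]<\infty$ for some $\varepsilon>0$, and set $\mu=\mathbb{E}[R]$. Let $T_n$ be the continuous cover time of $\mathbb{Z}/n\mathbb{Z}$ for the covering process with radius distribution $R$. Then, as $n\to\infty$, $$\frac{\mu}{n}T_n-\ln n\ \Longrightarrow\ \mathrm{Gumbel}(0,1)$$ in distribution.
   Context: Covering process: let $R$ be a random variable with values in $\{1,2,\dots\}$ and $f(r)=\mathbb{P}(R\ge r)$ for real $r\ge 1$ (so $f(1)=1$). For $n\ge1$ consider the discrete torus $\mathbb{Z}/n\mathbb{Z}=\{0,\dots,n-1\}$. Let $(R_k)_{k\ge1}$ be i.i.d. copies of $R$ and $(U_k)_{k\ge1}$ i.i.d. uniform on $\mathbb{Z}/n\mathbb{Z}$, independent of each other. The $k$-th object is the arc $\mathcal{O}_k=\{U_k,U_k+1,\dots,U_k+R_k-1\}\subset\mathbb{Z}/n\mathbb{Z}$ (addition mod $n$). Set $C_0=\emptyset$, $C_k=C_{k-1}\cup\mathcal{O}_k$. Let $(N(t))_{t\ge0}$ be a rate-one Poisson process independent of everything, and define the continuous-time covering process $X_t=C_{N(t)}$ and the continuous cover time $T_n=\inf\{t: X_t=\mathbb{Z}/n\mathbb{Z}\}$. $\mathrm{Gumbel}(0,1)$ denotes the law with $\mathbb{P}(G<t)=\exp(-e^{-t})$. *)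

(* Defs.v *)
From HB Require Import structures.
From mathcomp Require Import all_boot all_order all_algebra.
From mathcomp Require Import all_classical all_reals all_analysis.
Set Implicit Arguments. Unset Strict Implicit. Unset Printing Implicit Defensive.
Import Order.TTheory GRing.Theory Num.Theory numFieldNormedType.Exports.
Local Open Scope classical_set_scope.
Local Open Scope ring_scope.

(* Radius law: p j = P(R = j).  R takes values in {1,2,...}. *)
Definition radius_law (R : realType) (p : nat -> R) : Prop :=
  p 0%N = 0 /\ (forall j, 0 <= p j) /\ (series p @ \oo) --> (1 : R).

Definition moment_1eps (R : realType) (p : nat -> R) : Prop :=
  exists2 eps : R, 0 < eps &
    cvg (series (fun j => p j * (j%:R `^ (1 + eps))) @ \oo).

Definition mean_radius (R : realType) (p : nat -> R) : R :=
  lim (series (fun j => p j * j%:R) @ \oo).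

(* The k-th object (k = 0,1,2,...; the paper's k+1-th) is the arc
   {U_k, U_k+1, ..., U_k+R_k-1} mod n, as a subset of {0,...,n-1} ⊆ nat. *)
Definition arc (n u r : nat) : set nat :=
  [set x | (x < n)%N /\ exists2 i, (i < r)%N & x = ((u + i) %% n)%N].

(* Arrival time of object k: S_k = E_0 + ... + E_k, with E_i i.i.d. Exp(1)
   inter-arrival times of the rate-one Poisson process N(t) = #{k | S_k <= t}. *)
Definition arrival (R : realType) (T : Type) (E : nat -> T -> R) (k : nat) (w : T) : R :=
  \sum_(i < k.+1) E i w.

Definition covered (R : realType) (T : Type) (n : nat) (Rad U : nat -> T -> nat)
    (E : nat -> T -> R) (t : R) (w : T) : set nat :=
  \bigcup_(k in [set k | arrival E k w <= t]) arc n (U k w) (Rad k w).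

Definition cover_time (R : realType) (T : Type) (n : nat) (Rad U : nat -> T -> nat)
    (E : nat -> T -> R) (w : T) : \bar R :=
  ereal_inf [set t%:E | t in [set t : R | 0 <= t /\
                 covered n Rad U E t w = [set x | (x < n)%N]]].

(* The covering model on Z/nZ: (R_k), (U_k), (E_k) are all mutually independent,
   R_k ~ p, U_k uniform on {0,..,n-1}, E_k ~ Exp(1). Independence is stated as the
   product rule for the joint law of every finite initial family (R,U are discrete,
   so singletons suffice for them). *)
Definition covering_model (R : realType) (d : measure_display) (T : measurableType d)
    (p : nat -> R) (n : nat) (P : probability T R)
    (Rad U : nat -> T -> nat) (E : nat -> T -> R) : Prop :=
  (forall k j, measurable [set w | Rad k w = j]) /\
  (forall k j, measurable [set w | U k w = j]) /\
  (forall k, measurable_fun setT (E k)) /\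
  (forall (m : nat) (j u : nat -> nat) (D : nat -> set R),
     (forall k, measurable (D k)) ->
     P (\bigcap_(k in [set k | (k < m)%N])
          [set w | Rad k w = j k /\ U k w = u k /\ D k (E k w)]) =
     (\prod_(k < m)
        ((p (j k))%:E * (if (u k < n)%N then (n%:R)^-1 else 0)%:E
           * exponential_prob 1 (D k)))%E).

(* Main.v *)
(* Sampled at a fixed time, the covering process is a family of independent
   present-or-absent arcs, an arc of a type arriving at rate [c] being absent at
   time [s] with probability [expR (- (s * c))].  Hence the probability that a
   set [Z] of sites is vacant is [expR (- (s * q Z))], where [q Z] is the
   probability that one object hits [Z].
   Conditionally on [x] being vacant, the other arcs are unchanged and those
   through [x] are removed.  Revealing the sites one at a time therefore gives
     |P(no vacant site) - (1 - v)^n| <= sum over pairs of P(x, y vacant) - v^2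
   with [v] the vacancy probability of a site: only pair correlations matter.
   If [y] is at cyclic distance [g] from [x], an object of radius [r] hits
   [{x, y}] from at least [min r g + min r (n - g)] starting points.  At time
   [s = n (ln n + t) / mu] the pairs at distance at least [n^(1/(2 mu))]
   contribute [o(1)] because [mu - E[min R g] <= C g^-eps], and the few closer
   ones because [E[min R g] >= 1]; finally [n v --> expR (- t)]. *)
Require Import Defs.
From HB Require Import structures.
From mathcomp Require Import all_boot all_order all_algebra.
From mathcomp Require Import ring lra zify.
Set Implicit Arguments. Unset Strict Implicit. Unset Printing Implicit Defensive.
Import Order.TTheory GRing.Theory Num.Theory.
Local Open Scope ring_scope.

(** * Covering a finite set by independent random sets *)

Section IndependentSets.
Variables (R : realFieldType) (X : finType).
Implicit Types (l : seq ({set X} * R)) (Y Z D g : {set X}) (x : X).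

(* An entry [(g, e)] of [l] stands for the set [g], absent with probability [e]
   independently of the others; [cover_prob l Y Z] is the probability that every
   point of [Y] is covered and no point of [Z] is. *)
Fixpoint cover_prob l Y Z : R :=
  if l is (g, e) :: l' then
    e * cover_prob l' Y Z
    + (1 - e) * (if [disjoint g & Z] then cover_prob l' (Y :\: g) Z else 0)
  else (Y == set0)%:R.

Definition vacant_prob l Z : R :=
  \prod_(a <- l) (if [disjoint a.1 & Z] then 1 else a.2).

Definition absent_probs l := all (fun a => 0 <= a.2 <= 1) l.

Definition avoiding x l := [seq a : {set X} * R <- l | x \notin a.1].

Lemma vacant_prob_cons g e l Z : vacant_prob ((g, e) :: l) Z =
  (if [disjoint g & Z] then 1 else e) * vacant_prob l Z.
Proof. by rewrite /vacant_prob big_cons. Qed.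

Lemma cover_prob0 l Z : cover_prob l set0 Z = vacant_prob l Z.
Proof.
elim: l => [|[g e] l IH] /=; first by rewrite eqxx /vacant_prob big_nil.
by rewrite set0D IH vacant_prob_cons; case: ifP => _; ring.
Qed.

Lemma disjoint_U1r g x Z :
  [disjoint g & x |: Z] = (x \notin g) && [disjoint g & Z].
Proof. rewrite -!setI_eq0 setIUr setU_eq0; congr (_ && _).
by rewrite setI_eq0 disjoint_sym disjoints1. Qed.

Lemma disjoint_1r g x : [disjoint g & [set x]] = (x \notin g).
Proof. by rewrite disjoint_sym disjoints1. Qed.

Lemma setU1D_in x Y g : x \in g -> (x |: Y) :\: g = Y :\: g.
Proof.
move=> xg; apply/setP => y; rewrite !inE.
by case: eqVneq => [->|_] //=; rewrite xg.
Qed.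

Lemma setU1D_notin x Y g : x \notin g -> (x |: Y) :\: g = x |: (Y :\: g).
Proof.
move=> xg; apply/setP => y; rewrite !inE.
by case: eqVneq => [->|_] //=; rewrite xg.
Qed.

Lemma cover_probU1 l Y Z x : x \notin Y ->
  cover_prob l Y Z = cover_prob l (x |: Y) Z + cover_prob l Y (x |: Z).
Proof.
elim: l Y => [|[g e] l IH] Y xY /=.
  suff -> : (x |: Y == set0) = false by rewrite add0r.
  by apply/eqP => /setP/(_ x); rewrite !inE eqxx.
rewrite (IH Y xY) disjoint_U1r.
have [xg|xg] /= := boolP (x \in g); first by rewrite setU1D_in//; ring.
rewrite setU1D_notin//; case: ifP => _; last by ring.
by rewrite (IH (Y :\: g)) ?inE ?(negPf xY) ?andbF//; ring.
Qed.

(** Vacancy of [x] forces every set through [x] to be absent, which costs the first factor. The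
    other sets keep their law and must cover [Y] alone. *)
Lemma cover_prob1 l Y x : x \notin Y ->
  cover_prob l Y [set x] = vacant_prob l [set x] * cover_prob (avoiding x l) Y set0.
Proof.
elim: l Y => [|[g e] l IH] Y xY /=; first by rewrite /vacant_prob big_nil mul1r.
rewrite vacant_prob_cons disjoint_1r (IH Y xY).
have [xg|xg] /= := boolP (x \in g); first by ring.
rewrite IH ?inE ?(negPf xY) ?andbF// -setI_eq0 setI0 eqxx; ring.
Qed.

(** A chain rule: the second factor is the conditional probability that [y] is vacant given that [x]
    is, the sets through both points being already absent. *)
Lemma vacant_prob2 l x y :
  vacant_prob l [set x] * vacant_prob (avoiding x l) [set y] =
  vacant_prob l [set x; y].
Proof.
elim: l => [|[g e] l IH] /=; first by rewrite /vacant_prob !big_nil mul1r.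
rewrite !vacant_prob_cons -IH disjoint_U1r !disjoint_1r.
have [xg|xg] /= := boolP (x \in g); first by ring.
by rewrite vacant_prob_cons disjoint_1r; case: ifP => _; ring.
Qed.

Lemma vacant_prob_ge0 l Z : absent_probs l -> 0 <= vacant_prob l Z.
Proof.
elim: l => [|[g e] l IH] /=; first by rewrite /vacant_prob big_nil.
move=> /andP[/andP[e0 e1] /IH l0]; rewrite vacant_prob_cons.
by apply: mulr_ge0 => //; case: ifP.
Qed.

Lemma cover_prob_ge0 l Y Z : absent_probs l -> 0 <= cover_prob l Y Z.
Proof.
elim: l Y => [|[g e] l IH] Y /=; first by case: eqP.
move=> /andP[/andP[e0 e1] l0]; apply: addr_ge0; apply: mulr_ge0 => //.
- exact: IH.
- by rewrite subr_ge0.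
- by case: ifP => // _; exact: IH.
Qed.

(** Asking for more covered points shrinks the event; the induction drops the points of [Y] one at a
    time through [cover_probU1]. *)
Lemma cover_prob_le_vacant l Y Z : absent_probs l ->
  cover_prob l Y Z <= vacant_prob l Z.
Proof.
move=> l01; rewrite -cover_prob0.
suff: forall A, cover_prob l A Z <= cover_prob l set0 Z by [].
move=> A; have [m] := ubnP #|A|; elim: m A => // m IH A Am.
have [->//|[x xA]] := set_0Vmem A.
apply: le_trans (IH (A :\ x) _); last by move: Am; rewrite (cardsD1 x) xA.
rewrite (@cover_probU1 _ (A :\ x) _ x) ?setD1K// ?setD11//.
by rewrite lerDl cover_prob_ge0.
Qed.


(** A union bound: the difference is the probability that [Y] is covered while some point of [D] is
    missed. *)
Lemma cover_probU l Y D : absent_probs l -> [disjoint D & Y] ->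
  0 <= cover_prob l Y set0 - cover_prob l (D :|: Y) set0
    <= \sum_(y in D) vacant_prob l [set y].
Proof.
move=> l01; have [m] := ubnP #|D|; elim: m D => // m IH D Dm dDY.
have [->|[x xD]] := set_0Vmem D; first by rewrite big_set0 set0U subrr lexx.
have xY : x \notin Y by rewrite (disjointFr dDY).
have /IH : (#|D :\ x| < m)%N by move: Dm; rewrite (cardsD1 x) xD.
have /[swap]/[apply]/andP[] : [disjoint D :\ x & Y].
  by apply: disjointWl dDY; exact: subsetDl.
have /(@cover_probU1 l _ set0) -> : x \notin D :\ x :|: Y.
  by rewrite !inE eqxx.
rewrite setUA setD1K// setU0 (big_setD1 x xD)/=.
have := cover_prob_ge0 (D :\ x :|: Y) [set x] l01.
have := cover_prob_le_vacant (D :\ x :|: Y) [set x] l01.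
lra.
Qed.

(** Withdrawing the sets through [x] makes covering [Y] less likely. The loss is at most the
    expected number of points of [Y] that are covered before the withdrawal and vacant after it. *)
Lemma cover_prob_avoiding l Y x : absent_probs l ->
  0 <= cover_prob l Y set0 - cover_prob (avoiding x l) Y set0
    <= \sum_(y in Y)
         (vacant_prob (avoiding x l) [set y] - vacant_prob l [set y]).
Proof.
elim: l Y => [|[g e] l IH] Y /=.
  by rewrite subrr big1 ?lexx// => y _; rewrite subrr.
move=> /andP[/andP[e0 e1] l01].
have disj0 : [disjoint g & set0] by rewrite -setI_eq0 setI0.
have vE y : vacant_prob ((g, e) :: l) [set y] =
    (if y \in g then e else 1) * vacant_prob l [set y].
  by rewrite vacant_prob_cons disjoint_1r if_neg.
have splitY (F : X -> R) : \sum_(y in Y) F y =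
    \sum_(y in Y :&: g) F y + \sum_(y in Y :\: g) F y.
  by rewrite (big_setID g).
have /andP[I1 I2] := IH Y l01; have /andP[J1 J2] := IH (Y :\: g) l01.
(* If [g] contains [x], withdrawing it matters with probability [1 - e] and exposes only points of
   [Y :&: g], to which [cover_probU] applies. Otherwise [g] plays the same part on both sides, and
   the bound is the average of the induction hypotheses for [Y] and [Y :\: g]. *)
have [xg|xg] /= := boolP (x \in g); rewrite disj0.
- have : [disjoint Y :&: g & Y :\: g].
    by rewrite -setI_eq0; apply/eqP/setP => y; rewrite !inE; case: (y \in g); rewrite ?andbF.
  move=> /(cover_probU l01); rewrite setID => /andP[K1 K2].
  have -> : \sum_(y in Y) (vacant_prob (avoiding x l) [set y] -
        vacant_prob ((g, e) :: l) [set y]) =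
      \sum_(y in Y) (vacant_prob (avoiding x l) [set y] - vacant_prob l [set y])
      + (1 - e) * \sum_(y in Y :&: g) vacant_prob l [set y].
    rewrite !splitY mulr_sumr [RHS]addrAC -big_split/=; congr (_ + _);
      apply: eq_bigr => y; rewrite inE vE.
      by move=> /andP[_ ->] /=; ring.
    by move=> /andP[/negPf-> _] /=; ring.
  nra.
- have -> : \sum_(y in Y) (vacant_prob ((g, e) :: avoiding x l) [set y] -
        vacant_prob ((g, e) :: l) [set y]) =
      e * \sum_(y in Y) (vacant_prob (avoiding x l) [set y] - vacant_prob l [set y])
      + (1 - e) * \sum_(y in Y :\: g)
          (vacant_prob (avoiding x l) [set y] - vacant_prob l [set y]).
    rewrite !splitY mulrDr !mulr_sumr -addrA -big_split/=; congr (_ + _);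
      apply: eq_bigr => y; rewrite inE !vacant_prob_cons !disjoint_1r.
      by move=> /andP[_ ->] /=; ring.
    by move=> /andP[/negPf-> _] /=; ring.
  nra.
Qed.

(** The difference equals the vacancy probability of [x] times the drop in the probability of
    covering [Y] when [x] is known to be vacant. [cover_prob_avoiding] bounds that drop, and
    [vacant_prob2] turns the bound into covariances. *)
Lemma cover_prob_setU1 l Y x : absent_probs l -> x \notin Y ->
  `|cover_prob l (x |: Y) set0 - (1 - vacant_prob l [set x]) * cover_prob l Y set0|
  <= \sum_(y in Y) (vacant_prob l [set x; y] -
                     vacant_prob l [set x] * vacant_prob l [set y]).
Proof.
move=> l01 xY; have := cover_probU1 l set0 xY; rewrite setU0 cover_prob1// => E.
have /andP[A1 A2] := cover_prob_avoiding Y x l01.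
have v0 := vacant_prob_ge0 [set x] l01.
under eq_bigr do rewrite -vacant_prob2 -mulrBr; rewrite -mulr_sumr.
rewrite (_ : _ - _ = vacant_prob l [set x] *
  (cover_prob l Y set0 - cover_prob (avoiding x l) Y set0)); last first.
  by rewrite E; ring.
by rewrite ger0_norm ?mulr_ge0// ler_wpM2l.
Qed.

(** The points are added one at a time. Each addition multiplies the earlier error by [1 - v], which
    lies in [0, 1], so errors add up without being amplified. *)
Lemma cover_prob_near_product l v (b : X -> X -> R) : absent_probs l ->
  (forall x, vacant_prob l [set x] = v) -> v <= 1 ->
  (forall x y, x != y -> vacant_prob l [set x; y] - v ^+ 2 <= b x y) ->
  (forall x y, 0 <= b x y) ->
  `|cover_prob l setT set0 - (1 - v) ^+ #|{: X}| |
  <= \sum_x \sum_(y | y != x) b x y.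
Proof.
move=> l01 vE v1 vb b0.
have v0 x : 0 <= v by rewrite -(vE x) vacant_prob_ge0.
suff H (s : seq X) : uniq s ->
    `|cover_prob l [set x in s] set0 - (1 - v) ^+ size s|
    <= \sum_(x <- s) \sum_(y | y != x) b x y.
  have := H (enum X) (enum_uniq X); rewrite -cardT big_enum/=.
  suff -> : [set x in enum X] = setT by [].
  by apply/setP => x; rewrite !inE mem_enum.
elim: s => [_|x s IH].
  have -> : [set x in [::]] = set0 :> {set X} by apply/setP => y; rewrite !inE.
  by rewrite cover_prob0 big_nil expr0 /vacant_prob big1 ?subrr ?normr0// => a _;
    rewrite -setI_eq0 setI0 eqxx.
move=> /= /andP[xs us]; rewrite big_cons set_cons exprS.
have xs' : x \notin [set z in s] by rewrite inE.
have := cover_prob_setU1 l01 xs'; rewrite vE => H1.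
have H2 : \sum_(y in [set z in s])
    (vacant_prob l [set x; y] - v * vacant_prob l [set y])
    <= \sum_(y | y != x) b x y.
  apply: (@le_trans _ _ (\sum_(y in [set z in s]) b x y)).
    apply: ler_sum => y ys; rewrite vE -expr2; apply: vb.
    by apply: contraNneq xs' => ->.
  (* The points of [s] differ from [x] and [b] is nonnegative, so the sum may be extended to all
     [y != x]. *)
  rewrite [leLHS]big_mkcond [leRHS]big_mkcond/=; apply: ler_sum => y _.
  by case: ifPn => [ys|_]; case: ifPn => // /negbNE/eqP yx; rewrite yx (negPf xs') in ys.
set Q := cover_prob l [set z in s] set0 in H1 *.
rewrite (_ : _ - _ = (cover_prob l (x |: [set z in s]) set0 - (1 - v) * Q)
  + (1 - v) * (Q - (1 - v) ^+ size s)); last by ring.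
apply: le_trans (ler_normD _ _) _; apply: lerD; first exact: le_trans H1 H2.
rewrite normrM ger0_norm ?subr_ge0//.
apply: le_trans (IH us); apply: ler_piMl => //.
by rewrite lerBlDl lerDr v0.
Qed.

End IndependentSets.

(* Imported only now: [classical_sets] shadows the notations of [finset]. *)
From mathcomp Require Import all_classical all_reals all_analysis.
From mathcomp Require Import measurable_realfun.
Import Order.TTheory GRing.Theory Num.Theory numFieldNormedType.Exports.
Local Open Scope classical_set_scope.
Local Open Scope ring_scope.

(** * Independence of arrivals and objects *)

Definition expo (R : realType) : probability (measurableTypeR R) R.
Proof. refine (exponential_prob (1 : R)); exact: ltr01. Defined.

Section ProductLaw.
Local Open Scope ereal_scope.
Context (R : realType) (d d1 d2 : measure_display) (T : measurableType d)
  (T1 : measurableType d1) (T2 : measurableType d2).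
Variables (P : probability T R) (X : T -> T1) (Y : T -> T2) (F : set T).
Hypotheses (mX : measurable_fun setT X) (mY : measurable_fun setT Y).
Hypothesis mF : measurable F.

(** Both sides are finite measures in [C] that agree on rectangles, so uniqueness of the product
    measure applies, with the weight [K] absorbed in the second factor. *)
Lemma product_law (Q : probability T2 R) (K : R) : (0 <= K)%R ->
  (forall A B, measurable A -> measurable B ->
    P (F `&` X @^-1` A `&` Y @^-1` B) = P (X @^-1` A) * (K%:E * Q B)) ->
  forall C : set (T1 * T2), measurable C ->
  P (F `&` (fun w => (X w, Y w)) @^-1` C) = K%:E * (pushforward P X \x Q) C.
Proof.
move=> K0 PK C mC.
pose X' : {mfun T >-> T1} := mfun_Sub (mem_set mX).
pose m1 : probability T1 R := distribution P X'.
pose m2 : {finite_measure set T2 -> \bar R} := mscale (NngNum K0) Q.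
have mXY : measurable_fun setT (fun w => (X w, Y w)) by exact: measurable_fun_pair.
pose XY' : {mfun T >-> (T1 * T2)%type} := mfun_Sub (mem_set mXY).
pose m' : {measure set _ -> \bar R} := pushforward (mrestr P mF) XY'.
have H : P (F `&` (fun w => (X w, Y w)) @^-1` C) = m' mXY C.
  by rewrite setIC.
rewrite H; have := @product_measure_unique _ _ _ _ R m1 m2 (m' mXY).
move=> <- //.
  rewrite /product_measure1/= -ge0_integralZl//=.
  exact: (measurable_fun_xsection Q).
move=> A B mA mB; rewrite /m'/= /pushforward/= /mrestr/= setIC -[RHS](PK A B)//.
by congr (P _); rewrite -setIA.
Qed.

Lemma product_law_fin (Q : probability T2 R) (C : set (T1 * T2)) : measurable C ->
  (pushforward P X \x Q) C \is a fin_num.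
Proof.
pose X' : {mfun T >-> T1} := mfun_Sub (mem_set mX).
pose m1 : probability T1 R := distribution P X'.
exact: (fin_num_measure (product_subprobability
  ((m1 : subprobability _ _), (Q : subprobability _ _)))).
Qed.
End ProductLaw.

Lemma measure_nat_fibers (R : realType) d (T : measurableType d)
    (mu : {measure set T -> \bar R}) (X : T -> nat) (F : set T) :
  measurable F -> (forall j, measurable [set w | X w = j]) ->
  (mu F = \sum_(j <oo) mu (F `&` [set w | X w = j]))%E.
Proof.
move=> mF mX; rewrite -measure_semi_bigcup//.
- by congr (mu _); apply/seteqP; split => [w Fw|w [j _ []//]]; exists (X w).
- by move=> j; exact: measurableI.
- apply/trivIsetP => i j _ _ /eqP ij; rewrite -subset0 => w [[_ Xi] [_ Xj]].
  by apply: ij; rewrite -Xi -Xj.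
- by apply: bigcup_measurable => j _; exact: measurableI.
Qed.

Section IndependentObjects.
Context (R : realType) (d : measure_display) (T : measurableType d).
Variables (p : nat -> R) (n : nat) (P : probability T R).
Variables (Rad U : nat -> T -> nat) (E : nat -> T -> R).
Hypotheses (n_gt0 : (0 < n)%N) (hp : radius_law p).
Hypothesis hm : covering_model p n P Rad U E.

(* [sum_wait k.+1] is [arrival E k]. *)
Definition sum_wait m (w : T) : R := \sum_(i < m) E i w.

Definition past (h : nat -> nat -> nat -> bool) m :=
  \bigcap_(k in [set k | (k < m)%N]) [set w | h k (Rad k w) (U k w)].

Definition future (j u : nat -> nat) (D : nat -> set R) m M :=
  \bigcap_(k in [set k | (m <= k < M)%N])
    [set w | Rad k w = j k /\ U k w = u k /\ D k (E k w)].

Definition step_prob (j u : nat) (D : set R) : \bar R :=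
  ((p j)%:E * (if (u < n)%N then (n%:R)^-1 else 0)%:E * expo R D)%E.

(* [arc_law h] is the probability that [h (R_k) (U_k)] holds. *)
Definition arc_law (h : nat -> nat -> bool) : \bar R :=
  (\sum_(j <oo) (p j * (\sum_(u < n) (h j u)%:R) / n%:R)%:E)%E.

Let mRad k j : measurable [set w | Rad k w = j].
Proof. by case: hm => + _; exact. Qed.

Let mU k j : measurable [set w | U k w = j].
Proof. by case: hm => _ [+ _]; exact. Qed.

Let mE k : measurable_fun setT (E k).
Proof. by case: hm => _ [_ [+ _]]; exact. Qed.

Lemma measurable_sum_wait m : measurable_fun setT (sum_wait m).
Proof. by apply: measurable_sum => i; exact: mE. Qed.

(** The model makes only the fibres of [Rad k] and [U k] measurable, hence the countable union over
    their values. *)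
Lemma measurable_object k (h : nat -> nat -> bool) :
  measurable [set w | h (Rad k w) (U k w)].
Proof.
rewrite (_ : [set _ | _] = \bigcup_j \bigcup_u ([set w | Rad k w = j] `&`
   [set w | U k w = u] `&` (if h j u then setT else set0))).
  apply: bigcup_measurable => j _; apply: bigcup_measurable => u _.
  by apply: measurableI; [exact: measurableI|case: ifP].
apply/seteqP; split => [w /= hw|w /= [j _ [u _ [[<- <-]]]]].
  by exists (Rad k w) => //; exists (U k w) => //; rewrite hw.
by case: ifP.
Qed.

Lemma measurable_past h m : measurable (past h m).
Proof. by apply: bigcap_measurableType => k _; exact: measurable_object. Qed.

Lemma measurable_future j u D m M : (forall k, measurable (D k)) ->
  measurable (future j u D m M).
Proof.
move=> mD; apply: bigcap_measurableType => k _.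
rewrite (_ : [set _ | _] = [set w | Rad k w = j k] `&`
  ([set w | U k w = u k] `&` E k @^-1` D k))//.
apply: measurableI => //; apply: measurableI => //.
by rewrite -[X in measurable X]setTI; exact: mE.
Qed.

Let p_ge0 j : 0 <= p j. Proof. by case: hp => _ []. Qed.

Lemma step_prob_ge0 j u D : (0 <= step_prob j u D)%E.
Proof. by rewrite /step_prob !mule_ge0// lee_fin//; case: ifP. Qed.

Let weight_ge0 (h : nat -> nat -> bool) j :
  0 <= p j * (\sum_(u < n) (h j u)%:R) / n%:R.
Proof. by rewrite !mulr_ge0// ?invr_ge0// sumr_ge0. Qed.

Lemma arc_law_ge0 h : (0 <= arc_law h)%E.
Proof. by apply: nneseries_ge0 => j _ _; rewrite lee_fin. Qed.

Lemma sum_step_prob h :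
  (\sum_(j <oo) \sum_(u <oo) (if h j u then step_prob j u setT else 0) =
   arc_law h)%E.
Proof.
apply: eq_eseriesr => j _.
rewrite (nneseries_split 0 n); last first.
  by move=> u _; case: ifP => // _; exact: step_prob_ge0.
rewrite [X in (_ + X)%E]eseries0 ?adde0; last first.
  move=> u nu _; rewrite /step_prob ltnNge nu/= mule0 mul0e; by case: ifP.
rewrite big_mkord mulr_sumr mulr_suml -sumEFin; apply: eq_bigr => u _.
rewrite /step_prob probability_setT mule1 ltn_ord -EFinM.
by case: ifP; rewrite ?mulr1// mulr0 mul0r.
Qed.

Lemma arc_lawT : arc_law (fun _ _ => true) = 1%E.
Proof.
rewrite /arc_law; apply/cvg_lim => //.
under eq_fun do rewrite sumEFin.
apply: cvg_EFin; first by near=> k.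
case: hp => _ [_]; rewrite /series/=.
apply: cvg_trans; apply: near_eq_cvg; near=> k => /=.
apply: eq_bigr => j _; rewrite sumr_const card_ord -mulrA divff ?mulr1//.
by rewrite pnatr_eq0 -lt0n.
Unshelve. all: by end_near. Qed.

Lemma arc_law_fin h : arc_law h \is a fin_num.
Proof.
rewrite ge0_fin_numE ?arc_law_ge0//; apply: (@le_lt_trans _ _ 1%E); last exact: ltry.
rewrite -arc_lawT; apply: lee_nneseries => j _; rewrite lee_fin//.
rewrite !ler_wpM2r ?invr_ge0// ler_wpM2l// ler_sum// => u _.
by rewrite ler_nat leq_b1.
Qed.

Lemma step_prob_fin j u D : measurable D -> step_prob j u D \is a fin_num.
Proof. by move=> mD; rewrite /step_prob !fin_numM// fin_num_measure. Qed.

Let prod_fin I (r : seq I) (Q : pred I) (F : I -> \bar R) :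
  (forall i, Q i -> F i \is a fin_num) -> (\prod_(i <- r | Q i) F i)%E \is a fin_num.
Proof. by move=> FQ; elim/big_ind : _ => // x y; exact: fin_numM. Qed.

(* The objects before [m] enter through arbitrary events [h], those from [m] on
   through the rectangles of [covering_model]; the induction on [m] moves one
   object from the second kind to the first. *)
Definition independent_at m := forall M h j u D (B : set R), (m <= M)%N ->
  (forall k, measurable (D k)) -> measurable B ->
  (P (sum_wait m @^-1` B `&` past h m `&` future j u D m M) =
   P (sum_wait m @^-1` B) * (\prod_(k < m) arc_law (h k)) *
   \prod_(m <= k < M) step_prob (j k) (u k) (D k))%E.

Let independent_at0 : independent_at 0.
Proof.
move=> M h j u D B mM mD mB.
rewrite big_ord0 mule1 big_mkord.
have -> : past h 0 = setT by apply/seteqP; split => // w _ k.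
have prodE := hm.2.2.2 M j u D mD.
have -> : (\prod_(k < M) step_prob (j k) (u k) (D k))%E = P (future j u D 0 M).
  exact: esym prodE.
rewrite setIT; have [B0|B0] := pselect (B 0).
  have -> : sum_wait 0 @^-1` B = setT.
    by apply/seteqP; split => // w _; rewrite /= /sum_wait big_ord0.
  by rewrite setTI probability_setT mul1e.
have -> : sum_wait 0 @^-1` B = set0.
  by apply/seteqP; split => // w; rewrite /= /sum_wait big_ord0.
by rewrite set0I measure0 mul0e.
Qed.

Definition convolution m C : \bar R :=
  (@pushforward _ _ T (measurableTypeR R) R P (sum_wait m) \x expo R)%E
    [set z | C (z.1 + z.2)%R].

(** The event is split by the radius and start of object [m]. On each piece this object fits into a
    rectangle, so the hypothesis for [m] gives the joint law of [sum_wait m] and [E m]; summing over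
    the values allowed by [h' m] produces [arc_law (h' m)]. *)
Let independent_conv m (IH : independent_at m) M' h' j' u' D' C : (m < M')%N ->
  (forall k, measurable (D' k)) -> measurable C ->
  (P (sum_wait m.+1 @^-1` C `&` past h' m.+1 `&` future j' u' D' m.+1 M') =
   (\prod_(k < m) arc_law (h' k)) * arc_law (h' m) *
   (\prod_(m.+1 <= k < M') step_prob (j' k) (u' k) (D' k)) * convolution m C)%E.
Proof.
move=> mM' mD' mC.
set c := (\prod_(k < m) _)%E; set c' := (\prod_(m.+1 <= k < M') _)%E.
have mS := measurable_sum_wait.
have mCsum : measurable [set z : R * R | C (z.1 + z.2)].
  rewrite -[X in measurable X]setTI.
  by apply: (measurable_realfun.measurable_funD measurable_fst measurable_snd).
set conv := convolution m C.
set W := _ `&` _ `&` _.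
have mW : measurable W.
  apply: measurableI; last exact: measurable_future.
  apply: measurableI; last exact: measurable_past.
  by rewrite -[X in measurable X]setTI; exact: mS.
rewrite (measure_nat_fibers P mW (mRad m)).
have termE jj uu : P (W `&` [set w | Rad m w = jj] `&` [set w | U m w = uu]) =
    (c * c' * conv * (if h' m jj uu then step_prob jj uu setT else 0))%E.
  (* [upd] overrides entry [m]: object [m], with its radius and start fixed, becomes the first
     rectangle of the future. Its waiting time is left free in [F]. *)
  pose upd (V : Type) (f : nat -> V) v k := if k == m then v else f k.
  pose F := past h' m `&` future (upd _ j' jj) (upd _ u' uu) (upd _ D' setT) m M'.
  have mupd Dm : measurable Dm -> forall k, measurable (upd _ D' Dm k).
    by move=> mDm k; rewrite /upd; case: ifP.
  have futE Dm : future (upd _ j' jj) (upd _ u' uu) (upd _ D' Dm) m M' =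
      [set w | Rad m w = jj /\ U m w = uu /\ Dm (E m w)] `&`
      future j' u' D' m.+1 M'.
    apply/seteqP; split => [w fw|w [wm fw] k /= /andP[]].
      split; first by have := fw m; rewrite /upd/= eqxx leqnn mM'; exact.
      move=> k /= /andP[mk kM]; have := fw k.
      by rewrite /= /upd gtn_eqF// kM (ltnW mk); exact.
    rewrite leq_eqVlt /upd => /predU1P[<- _|mk kM]; first by rewrite eqxx.
    by rewrite gtn_eqF//; apply: fw => /=; rewrite mk.
  have prodE Dm : (\prod_(m <= k < M') step_prob (upd _ j' jj k) (upd _ u' uu k)
      (upd _ D' Dm k) = step_prob jj uu Dm * c')%E.
    rewrite big_ltn// /upd eqxx; congr (_ * _)%E.
    apply: eq_big_nat => k /andP[mk _]; by rewrite gtn_eqF.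
  have mF : measurable F.
    apply: measurableI; first exact: measurable_past.
    exact: (measurable_future _ _ _ _ (mupd _ measurableT)).
  have PF : P F = (c * (step_prob jj uu setT * c'))%E.
    rewrite -prodE -[LHS]mul1e -(probability_setT P).
    have := IH M' h' _ _ _ setT (ltnW mM') (mupd setT measurableT) measurableT.
    by rewrite preimage_setT setTI probability_setT mul1e => ->; rewrite mul1e.
  (* On [F], the elapsed time and the next waiting time obey the product rule on rectangles;
     [product_law] extends it to the event that their sum lies in [C]. *)
  have rect A B' : measurable A -> measurable B' ->
      (P (F `&` sum_wait m @^-1` A `&` E m @^-1` B') =
       P (sum_wait m @^-1` A) * ((fine (P F))%:E * expo R B'))%E.
    move=> mA mB'; rewrite fineK ?fin_num_measure// PF.
    have -> : F `&` sum_wait m @^-1` A `&` E m @^-1` B' =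
        sum_wait m @^-1` A `&` past h' m `&`
        future (upd _ j' jj) (upd _ u' uu) (upd _ D' B') m M'.
      rewrite /F !futE; apply/seteqP; split => w /=; tauto.
    rewrite (IH M' h' _ _ _ A (ltnW mM') (mupd _ mB') mA).
    rewrite prodE /step_prob probability_setT mule1 -!muleA.
    by do 4 congr (_ * _)%E; rewrite muleC.
  have PF0 : 0 <= fine (P F) by rewrite fine_ge0.
  have mS' : @measurable_fun _ _ T (measurableTypeR R) setT (sum_wait m) := mS m.
  have mE' : @measurable_fun _ _ T (measurableTypeR R) setT (E m) := mE m.
  have mCsum' : @measurable _ (measurableTypeR R * measurableTypeR R)%type
    [set z | C (z.1 + z.2)] := mCsum.
  have := @product_law R d _ _ T (measurableTypeR R) (measurableTypeR R) P
    (sum_wait m) (E m) F mS' mE' mF (expo R) (fine (P F)) PF0 rect _ mCsum'.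
  rewrite fineK ?fin_num_measure// PF.
  case: ifPn => [hm'|/negP hm'].
    rewrite (_ : F `&` _ = W `&` [set w | Rad m w = jj] `&` [set w | U m w = uu]).
      have mulCA (a b e f : \bar R) : (a * (e * b) * f = a * b * f * e)%E.
        by rewrite -!muleA; congr (_ * _)%E; rewrite muleC -muleA.
      by move=> ->; exact: mulCA.
    rewrite /F /W futE /sum_wait; apply/seteqP; split => w /=.
      rewrite big_ord_recr /= => -[[wp [[wR [wU _]] wf]] wC].
      split => //; split => //; split => //; split => // k.
      rewrite /= ltnS leq_eqVlt => /predU1P[->|]; first by rewrite wR wU.
      exact: wp.
    rewrite big_ord_recr/= => -[[[[wC wp] wf] wR] wU].
    by split => //; split=> [k /= km|//]; apply: wp => /=; exact: ltnW.
  move=> _; rewrite mule0 (_ : _ `&` _ = set0) ?measure0//.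
  rewrite -subset0 => w /= [[[[_ wp] _] wR] wU]; apply: hm'.
  by rewrite -wR -wU; exact: (wp m (ltnSn m)).
have c_fin : (c * c' * conv)%E \is a fin_num.
  have cf : c \is a fin_num by apply: prod_fin => i _; exact: arc_law_fin.
  have cf' : c' \is a fin_num.
    by apply: prod_fin => i _; apply: step_prob_fin.
  apply: fin_numM; first exact: fin_numM.
  have mS' : @measurable_fun _ _ T (measurableTypeR R) setT (sum_wait m) := mS m.
  have mCsum' : @measurable _ (measurableTypeR R * measurableTypeR R)%type
    [set z | C (z.1 + z.2)] := mCsum.
  exact: (product_law_fin P mS' (expo R) mCsum').
pose w jj uu := if h' m jj uu then step_prob jj uu setT else 0%E.
have w0 jj uu : (0 <= w jj uu)%E by rewrite /w; case: ifP => // _; exact: step_prob_ge0.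
transitivity (\sum_(jj <oo) (fine (c * c' * conv))%:E * \sum_(uu <oo) w jj uu)%E.
  apply: eq_eseriesr => jj _.
  rewrite (measure_nat_fibers P (measurableI _ _ mW (mRad m jj)) (mU m)).
  rewrite -nneseriesZl//; apply: eq_eseriesr => uu _.
  by rewrite fineK//; exact: termE.
rewrite nneseriesZl; last by move=> jj _; apply: nneseries_ge0.
rewrite sum_step_prob fineK//.
rewrite -!muleA; congr (_ * _)%E.
by rewrite [in RHS]muleC -muleA; congr (_ * _)%E; rewrite muleC.
Qed.

(** With trivial constraints on the objects, [independent_conv] identifies the convolution with the
    law of [sum_wait m.+1]. *)
Let conv_at m (IH : independent_at m) B : measurable B ->
  P (sum_wait m.+1 @^-1` B) = convolution m B.
Proof.
move=> mB.
have := independent_conv IH (M' := m.+1) (fun _ _ _ => true)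
  (fun _ => 0%N) (fun _ => 0%N) (D' := fun _ => setT) (C := B).
have -> : (\prod_(k < m) arc_law (fun _ _ => true) = 1)%E.
  by apply: big1 => i _; exact: arc_lawT.
move/(_ (ltnSn m) (fun=> measurableT) mB).
have -> : past (fun _ _ _ => true) m.+1 = setT by apply/seteqP; split => // w _ k.
have -> : future (fun _ => 0%N) (fun _ => 0%N) (fun _ => setT) m.+1 m.+1 = setT.
  by apply/seteqP; split => // w _ k /= /andP[mk]; rewrite ltnNge mk.
by rewrite !setIT (big_geq (leqnn m.+1)) arc_lawT !mul1e.
Qed.

Lemma objects_independent m : independent_at m.
Proof.
elim: m => [|m IH]; first exact: independent_at0.
move=> M h j u D B mM mD mB.
rewrite independent_conv// conv_at// big_ord_recr/=.
by rewrite muleC muleA.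
Qed.

Lemma sum_waitS_law m B : measurable B ->
  P (sum_wait m.+1 @^-1` B) = convolution m B.
Proof. exact/conv_at/objects_independent. Qed.

End IndependentObjects.

(** * Erlang law of the arrival times *)

(** Tonelli: once [Q] is written through its density, the integrals are exchanged and the inner one
    measures a section under [law]. *)
Lemma product_measure_density (R : realType) d1 d2 (T1 : measurableType d1)
    (T2 : measurableType d2) (law : {sigma_finite_measure set T1 -> \bar R})
    (mu : {sigma_finite_measure set T2 -> \bar R}) (g : T2 -> R)
    (Q : set T2 -> \bar R) (C : set (T1 * T2)) :
  measurable_fun setT g -> (forall y, 0 <= g y) ->
  (forall A, measurable A -> Q A = \int[mu]_(y in A) (g y)%:E)%E ->
  measurable C ->
  ((law \x Q) C = \int[mu]_y ((g y)%:E * law (ysection C y)))%E.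
Proof.
move=> mg g0 QE mC.
pose f (z : T1 * T2) := ((g z.2)%:E * (\1_C z)%:E)%E.
have mf : measurable_fun setT f.
  apply: emeasurable_funM; apply/measurable_EFinP; last exact: measurable_indic.
  exact: (measurableT_comp mg measurable_snd).
have f0 z : (0 <= f z)%E by rewrite mule_ge0// lee_fin.
transitivity (\int[law]_x \int[mu]_y f (x, y))%E.
  apply: eq_integral => x _.
  rewrite /= QE; last exact: measurable_xsection.
  rewrite integral_mkcond; apply: eq_integral => y _.
  by rewrite patchE /f indicE mem_xsection; case: ifP => _; rewrite ?mule1 ?mule0.
rewrite fubini_tonelli//; apply: eq_integral => y _.
rewrite (_ : (fun x => f (x, y)) =
  (fun x => (g y)%:E * (\1_(ysection C y) x)%:E)%E); last first.
  by apply/funext => x; rewrite /f !indicE mem_ysection.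
have mCy : measurable (ysection C y) by exact: measurable_ysection.
have mI : measurable_fun setT (fun x => (\1_(ysection C y) x)%:E : \bar R).
  by apply/measurable_EFinP; exact: measurable_indic.
rewrite ge0_integralZl// ?lee_fin//.
by rewrite integral_indic// setIT.
Qed.

Section ErlangLaw.
Context (R : realType) (d : measure_display) (T : measurableType d).

Lemma convolution_density (P : probability T R) (X : T -> R) (s : R) :
  measurable_fun setT X ->
  ((@pushforward _ _ T (measurableTypeR R) R P X \x expo R)
    [set z | (z.1 + z.2 <= s)%R] =
  \int[lebesgue_measure]_y ((exponential_pdf 1 y)%:E * P [set w | (X w <= s - y)%R]))%E.
Proof.
move=> mX.
have mX' : @measurable_fun _ _ T (measurableTypeR R) setT X := mX.
pose X' : {mfun T >-> measurableTypeR R} :=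
  @mfun_Sub _ _ T (measurableTypeR R) X (mem_set mX').
pose law : probability (measurableTypeR R) R := distribution P X'.
pose C := [set z : measurableTypeR R * measurableTypeR R | (z.1 + z.2 <= s)%R].
have mC : measurable C.
  rewrite (_ : C = [set: R * R] `&` (fst \+ snd) @^-1` `]-oo, s]).
    by apply: measurable_funD => //; exact: measurable_itv.
  by rewrite setTI; apply/seteqP; split => z /=; rewrite in_itv.
have := @product_measure_density R _ _ _ _ law lebesgue_measure (exponential_pdf 1) (expo R) C.
move=> -> //; last 2 first.
- exact: measurable_exponential_pdf.
- by move=> y; exact: exponential_pdf_ge0.
apply: eq_integral => y _; congr (_ * _)%E; congr (P _).
by apply/seteqP; split => w; rewrite /preimage/= /ysection/= in_setE/= lerBrDr.
Qed.

(** For [0 <= s], the distribution function of a sum of [m] independent Exp(1) variables, or the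
    probability that a Poisson variable of mean [s] is at least [m]. *)
Definition erlang_cdf m (s : R) : R :=
  1 - expR (- s) * \sum_(k < m) s ^+ k / k`!%:R.

(** A primitive in [y] of the integrand of the Erlang recursion, in which the product of
    exponentials collapses to the constant [expR (- s)]. *)
Let G m (s : R) y : R :=
  expR (- s) * \sum_(k < m) (s - y) ^+ k.+1 / k.+1`!%:R - expR (- y).

Let is_derive_G m s y : is_derive y (1 : R) (G m s)
  (expR (- y) * erlang_cdf m (s - y)).
Proof.
have dB : is_derive y (1 : R) (cst s - id) (-1).
  by apply: is_derive_eq; rewrite sub0r.
have dN : is_derive y (1 : R) (fun z : R => expR (- z)) (- expR (- y)).
  have dNid : is_derive y (1 : R) (fun z : R => - z) (-1) by exact: is_deriveN.
  apply: is_derive_eq (@is_derive1_comp _ expR _ _ _ _ (is_derive_expR (- y)) dNid) _.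
  by rewrite mulrN1.
have -> : G m s = expR (- s) \*: (\sum_(k < m)
    (k.+1`!%:R^-1 \*: ((cst s - id) ^+ k.+1))) - (fun z : R => expR (- z)).
  apply/funext => z; rewrite /G [RHS]/= fct_sumE; congr (_ - _).
  by congr (_ * _); apply: eq_bigr => k _; rewrite /= exprfctE mulrC.
have dS := @is_derive_sum R R R m (fun k => k.+1`!%:R^-1 \*: ((cst s - id) ^+ k.+1))
  y 1 _ (fun k => is_deriveZ _ (is_deriveX k.+1 dB)).
apply: is_derive_eq (is_deriveB (is_deriveZ (expR (- s)) dS) dN) _.
rewrite opprK /erlang_cdf mulrBr mulr1 addrC; congr (_ + _).
rewrite mulrA -expRD opprB addKr -mulrN; congr (_ * _).
rewrite -sumrN; apply: eq_bigr => k _; rewrite /= /GRing.scale/= mulrN1 mulrN.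
congr (- _); rewrite factS natrM invfM mulrACA mulVf ?mul1r; last first.
  by rewrite pnatr_eq0.
by rewrite mulrC.
Qed.

Let erlang_cdfS k t : erlang_cdf k.+1 t =
  1 - expR (- t) * (1 + \sum_(i < k) t ^+ i.+1 / i.+1`!%:R).
Proof. by rewrite /erlang_cdf big_ord_recl expr0 fact0 divr1. Qed.

Lemma integral_erlang m s : 0 <= s ->
  (\int[lebesgue_measure]_(y in `[0%R, s]) (expR (- y) * erlang_cdf m (s - y))%R%:E
   = (erlang_cdf m.+1 s)%:E)%E.
Proof.
rewrite le_eqVlt => /predU1P[<-|s0].
  rewrite set_itv1 integral_set1 erlang_cdfS big1 ?addr0.
    by rewrite oppr0 expR0 mulr1 subrr.
  by move=> i _; rewrite expr0n mul0r.
have cG k y : {for y, continuous (G k s)}.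
  have [dG _] := is_derive_G k s y.
  by apply: differentiable_continuous; exact/derivable1_diffP.
(* For [m = k.+1] the integrand is [- G k s] up to a constant, so its continuity follows from that
   of [G]; for [m = 0] it is a plain exponential. *)
have GE k y : expR (- y) * erlang_cdf k.+1 (s - y) = - G k s y - expR (- s).
  rewrite /G erlang_cdfS.
  have -> : - s = - y - (s - y) by ring.
  by rewrite expRD; ring.
rewrite (@continuous_FTC2 _ _ (G m s))//.
- rewrite -EFinB; congr EFin.
  rewrite /G erlang_cdfS subrr subr0 big1; last by move=> k _; rewrite expr0n mul0r.
  by rewrite oppr0 expR0; ring.
- apply: continuous_subspaceT => y; case: m => [|k].
    under eq_fun do rewrite /erlang_cdf big_ord0 mulr0 subr0 mulr1.
    apply: continuous_comp; last exact: continuous_expR.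
    exact: continuousN.
  under eq_fun do rewrite GE.
  by apply: cvgB; [apply: cvgN; exact: cG|exact: cvg_cst].
- split; first by move=> x _; have [] := is_derive_G m s x.
  + by apply: cvg_at_right_filter; exact: cG.
  + by apply: cvg_at_left_filter; exact: cG.
- move=> y _; rewrite derive1E; have ? := is_derive_G m s y; exact: derive_val.
Qed.

End ErlangLaw.

(** * Vacancy probabilities *)

Lemma expo_lt0 (R : realType) : expo R `]-oo, 0%R[%classic = 0%E.
Proof.
rewrite /= /exponential_prob integral0_eq// => y; rewrite /= in_itv/= => y0.
by rewrite lt0_exponential_pdf.
Qed.

Lemma poisson_abel_sum (R : realType) (s v : R) M :
  \sum_(k < M) (v ^+ k * (1 - v)) * erlang_cdf k.+1 s =
  1 - expR (- s) * \sum_(k < M) (s * v) ^+ k / k`!%:R - v ^+ M * erlang_cdf M s.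
Proof.
elim: M => [|M IH].
  by rewrite !big_ord0 /erlang_cdf big_ord0 mulr0 expr0; ring.
rewrite big_ord_recr/= IH [in RHS]big_ord_recr/= exprS exprMn /erlang_cdf big_ord_recr/=.
by ring.
Qed.

Lemma cvg_exp_sum (R : realType) (x : R) :
  (fun M => \sum_(k < M) x ^+ k / k`!%:R) @ \oo --> expR x.
Proof.
rewrite (_ : (fun M => _) = series (exp_coeff x)); first exact: is_cvg_series_exp_coeff.
by apply/funext => M; rewrite /series/= big_mkord.
Qed.

Lemma cvg_erlang_cdf (R : realType) (s : R) : erlang_cdf M s @[M --> \oo] --> (0 : R).
Proof.
have : (fun M => 1 - expR (- s) * \sum_(k < M) s ^+ k / k`!%:R) @ \oo -->
    1 - expR (- s) * expR s.
  by apply: cvgB; [exact: cvg_cst|apply: cvgM; [exact: cvg_cst|exact: cvg_exp_sum]].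
by rewrite [X in 1 - X]mulrC expRxMexpNx_1 subrr.
Qed.

(** Thinning: if each object hits with probability [q], the first hit has a geometric index and
    happens at an exponential time of rate [q]. *)
Lemma cvg_poisson_thinning (R : realType) (s q : R) : 0 <= q <= 1 ->
  (fun M => \sum_(k < M) ((1 - q) ^+ k * q) * erlang_cdf k.+1 s) @ \oo -->
  1 - expR (- (s * q)).
Proof.
move=> /andP[q0 q1].
have /= := @poisson_abel_sum R s (1 - q); rewrite subKr => /funext ->.
rewrite -[X in _ --> X]subr0; apply: cvgB.
  apply: cvgB; first exact: cvg_cst.
  rewrite (_ : - (s * q) = - s + s * (1 - q)); last by ring.
  by rewrite expRD; apply: cvgM; [exact: cvg_cst|exact: cvg_exp_sum].
apply/norm_cvg0P; apply: squeeze_cvgr (cvg_cst 0) (_ : `|erlang_cdf M s| @[M --> \oo] --> 0).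
  near=> M; rewrite normr_ge0/= normrM ler_piMl// normrX exprn_ile1//.
  by rewrite ger0_norm ?subr_ge0// lerBlDr lerDl.
by apply/norm_cvg0P; exact: cvg_erlang_cdf.
Unshelve. all: by end_near. Qed.

Section Vacancy.
Context (R : realType) (d : measure_display) (T : measurableType d).
Variables (p : nat -> R) (n : nat) (P : probability T R).
Variables (Rad U : nat -> T -> nat) (E : nat -> T -> R).
Hypotheses (n_gt0 : (0 < n)%N) (hp : radius_law p).
Hypothesis hm : covering_model p n P Rad U E.

(** Induction through the convolution formula. The density vanishes for [y < 0] and the previous
    distribution function at [s - y] vanishes for [y > s], which leaves the integral over
    [[0, s]]. *)
Lemma sum_wait_cdf m s : P [set w | sum_wait E m w <= s] =
  (if 0 <= s then erlang_cdf m s else 0)%:E.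
Proof.
elim: m s => [|m IH] s.
  rewrite /sum_wait; under eq_set do rewrite big_ord0.
  case: (lerP 0 s) => s0.
    rewrite (_ : [set _ | _] = setT) ?probability_setT; last by apply/seteqP; split.
    by rewrite /erlang_cdf big_ord0 mulr0 subr0.
  by rewrite (_ : [set _ | _] = set0) ?measure0//; apply/seteqP; split.
have mI : measurable (`]-oo, s] : set R) by exact: measurable_itv.
have := sum_waitS_law n_gt0 hp hm m mI.
rewrite (_ : _ @^-1` _ = [set w | sum_wait E m.+1 w <= s]); last first.
  by apply/seteqP; split => w /=; rewrite in_itv.
move=> ->; rewrite /convolution.
rewrite (_ : [set z | _] = [set z | (z.1 + z.2 <= s)%R]); last first.
  by apply/seteqP; split => w /=; rewrite in_itv.
rewrite convolution_density; last exact: (measurable_sum_wait hm).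
transitivity (\int[lebesgue_measure]_(y in `[0%R, s])
    (expR (- y) * erlang_cdf m (s - y))%R%:E)%E.
  rewrite [RHS]integral_mkcond; apply: eq_integral => y _.
  rewrite IH subr_ge0 patchE mem_setE in_itv/=.
  have [y0|y0] := lerP 0 y; last by rewrite lt0_exponential_pdf// mul0e.
  rewrite exponential_pdfE// mul1r mulN1r -EFinM.
  by case: ifP; rewrite ?mulr0.
case: (lerP 0 s) => s0; first exact: integral_erlang.
by rewrite set_itv_ge ?integral_set0// bnd_simp -ltNge.
Qed.

(** The waiting times are known only in law, so arrival times increase only almost surely; this is
    the exceptional set. *)
Lemma negative_wait_prob0 : P (\bigcup_k [set w | E k w < 0]) = 0%E.
Proof.
have mE k : measurable [set w | E k w < 0].
  rewrite (_ : [set _ | _] = setT `&` E k @^-1` `]-oo, 0[).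
    by case: hm => _ [_ [mE _]]; apply: mE => //; exact: measurable_itv.
  by rewrite setTI; apply/seteqP; split => w /=; rewrite in_itv.
have mN : measurable (\bigcup_k [set w | E k w < 0]) by exact: bigcup_measurable.
suff PE k : P [set w | E k w < 0] = 0%E.
  apply/(@negligibleP _ _ _ P) => //; apply: negligible_bigcup => k.
  by apply/(@negligibleP _ _ _ P); [exact: mE|exact: PE].
have [mRad [mU _]] := hm.
rewrite (measure_nat_fibers P (mE k) (mRad k)) eseries0// => j _ _.
rewrite (measure_nat_fibers P (measurableI _ _ (mE k) (mRad k j)) (mU k)).
rewrite eseries0// => u _ _.
have := @objects_independent _ _ _ p n P Rad U E n_gt0 hp hm k k.+1
  (fun _ _ _ => true) (fun _ => j) (fun _ => u) (fun _ => `]-oo, 0%R[%classic) setT (leqnSn k).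
rewrite big_nat1 /step_prob expo_lt0 !mule0 => /(_ (fun _ => measurable_itv _) measurableT).
have -> : past Rad U (fun _ _ _ => true) k = setT by apply/seteqP; split => // w _ i.
rewrite preimage_setT !setTI => H0; rewrite -[RHS]H0; congr (P _).
apply/seteqP; split => [w [[Ek Rk] Uk] i /= |w /(_ k)/=].
  rewrite ltnS -eqn_leq => /eqP <-; by rewrite in_itv.
by rewrite leqnn ltnSn in_itv/= => /(_ isT) [? []].
Qed.

Definition vacant_event (h : nat -> nat -> bool) s :=
  [set w | forall k, arrival E k w <= s -> ~~ h (Rad k w) (U k w)].

Lemma measurable_vacant_event h s : measurable (vacant_event h s).
Proof.
rewrite (_ : vacant_event h s = \bigcap_k ([set w | ~~ (sum_wait E k.+1 w <= s)] `|`
    [set w | ~~ h (Rad k w) (U k w)])); last first.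
  apply/seteqP; split => w vw k.
    move=> _; have [Sk|Sk] := boolP (sum_wait E k.+1 w <= s); last by left.
    by right; exact: (vw k Sk).
  by have [/negP nSk /nSk|] := vw k I.
apply: bigcap_measurableType => k _; apply: measurableU; last first.
  exact: (measurable_object hm k (fun j u => ~~ h j u)).
rewrite (_ : [set _ | _] = setT `&` sum_wait E k.+1 @^-1` `]s, +oo[).
  by apply: (measurable_sum_wait hm) => //; exact: measurable_itv.
by rewrite setTI; apply/seteqP; split => w /=; rewrite in_itv/= andbT ltNge.
Qed.

(* Decomposing according to the first object that satisfies [h]. *)
Let first_hit (h : nat -> nat -> bool) (k i : nat) j u := if i == k then h j u else ~~ h j u.

Lemma arc_lawC h : (arc_law p n (fun j u => ~~ h j u) = 1 - arc_law p n h)%E.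
Proof.
have p0 : forall j, 0 <= p j by case: hp => _ [].
suff : (arc_law p n h + arc_law p n (fun j u => ~~ h j u) = 1)%E.
  by move=> <-; rewrite addeAC subee ?add0e//; exact: (arc_law_fin n_gt0 hp).
rewrite -(arc_lawT n_gt0 hp).
rewrite /arc_law -nneseriesD.
- apply: eq_eseriesr => j _; rewrite -EFinD -mulrDl -mulrDr -big_split/=.
  congr (_ * _ / _)%:E; apply: eq_bigr => u _.
  by case: (h j u); rewrite ?addr0 ?add0r.
- by move=> j _ _; rewrite lee_fin !mulr_ge0// ?invr_ge0// sumr_ge0.
- by move=> j _ _; rewrite lee_fin !mulr_ge0// ?invr_ge0// sumr_ge0.
Qed.

(** Up to a null set, the complement is the disjoint union over [k] of the events [A k] that object
    [k] is the first to satisfy [h] and has arrived by time [s]. Object [k] arrives after [k.+1]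
    waits, and the probabilities of these events sum by [cvg_poisson_thinning]. *)
Lemma vacant_event_prob h s : 0 <= s ->
  P (vacant_event h s) = (expR (- (s * fine (arc_law p n h))))%:E.
Proof.
move=> s0; set q := fine _.
have qE : arc_law p n h = q%:E by rewrite fineK//; exact: (arc_law_fin n_gt0 hp).
have q01 : 0 <= q <= 1.
  have := arc_lawC h; rewrite qE -EFinB => qC.
  apply/andP; split; first by rewrite -lee_fin -qE; exact: (arc_law_ge0 n hp).
  by rewrite -subr_ge0 -lee_fin -qC; exact: (arc_law_ge0 n hp).
pose A k := [set w | sum_wait E k.+1 w <= s] `&` past Rad U (first_hit h k) k.+1.
have mS m : measurable [set w | sum_wait E m w <= s].
  rewrite (_ : [set _ | _] = setT `&` sum_wait E m @^-1` `]-oo, s]).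
    by apply: (measurable_sum_wait hm) => //; exact: measurable_itv.
  by rewrite setTI; apply/seteqP; split => w /=; rewrite in_itv.
have mA k : measurable (A k).
  by apply: measurableI => //; exact: (measurable_past hm).
have PA k : P (A k) = (((1 - q) ^+ k * q) * erlang_cdf k.+1 s)%:E.
  have := @objects_independent _ _ _ p n P Rad U E n_gt0 hp hm k.+1 k.+1
    (first_hit h k) (fun _ => 0%N) (fun _ => 0%N) (fun _ => setT) `]-oo, s]%classic
    (leqnn _) (fun _ => measurableT) (measurable_itv _).
  have -> : future Rad U E (fun _ => 0%N) (fun _ => 0%N) (fun _ => setT) k.+1 k.+1 = setT.
    by apply/seteqP; split => // w _ i /= /andP[mk]; rewrite ltnNge mk.
  have -> : sum_wait E k.+1 @^-1` `]-oo, s] = [set w | sum_wait E k.+1 w <= s].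
    by apply/seteqP; split => w /=; rewrite in_itv.
  rewrite setIT (big_geq (leqnn _)) mule1 => ->.
  rewrite sum_wait_cdf s0 muleC big_ord_recr/= {2}/first_hit eqxx.
  rewrite [X in (_ * X * _)%E](_ : _ = q%:E)//.
  rewrite (_ : (\prod_(i < k) _ = ((1 - q) ^+ k)%:E)%E) -?EFinM//.
  rewrite (eq_bigr (fun=> (1 - q)%:E)) => [|i _].
    by elim: k {mA A} => [|k IH]; rewrite ?big_ord0// big_ord_recr/= IH -EFinM exprSr.
  rewrite (_ : first_hit h k i = fun j u => ~~ h j u) ?arc_lawC ?qE//.
  by apply/funext => j; apply/funext => u; rewrite /first_hit ltn_eqF.
have tA : trivIset setT A.
  apply/trivIsetP => i j _ _; wlog ij : i j / (i < j)%N => [H|_].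
    by case: ltngtP => // ij _; [|rewrite setIC]; apply: H; rewrite ?lt_eqF.
  rewrite -subset0 => w [[_ wi] [_ wj]].
  have := wi i (ltnSn i); have := wj i (ltnW ij).
  by rewrite /first_hit/= eqxx ltn_eqF// => /negP.
have PUA : P (\bigcup_k A k) = (1 - expR (- (s * q)))%:E.
  rewrite measure_semi_bigcup//; last exact: bigcup_measurable.
  rewrite (eq_eseriesr (fun k _ => PA k)); apply/cvg_lim => //.
  under eq_fun do rewrite sumEFin big_mkord.
  by apply: cvg_EFin; [near=> k|exact: cvg_poisson_thinning].
have mV := measurable_vacant_event h s.
have subA : \bigcup_k A k `<=` ~` vacant_event h s.
  move=> w [k _ [Sk Ak]] /(_ k Sk)/negP; apply.
  by have := Ak k (ltnSn k); rewrite /first_hit/= eqxx.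
(* The first object satisfying [h] arrives no later than any other such object, provided that the
   waits in between are nonnegative. *)
have subV : ~` vacant_event h s `<=` \bigcup_k A k `|` \bigcup_k [set w | E k w < 0].
  move=> w /existsNP[k /not_implyP[Sk /negP/negPn hk]].
  have [?|noN] := pselect ((\bigcup_k [set w | E k w < 0]) w); [by right|left].
  have exk : exists k, h (Rad k w) (U k w) by exists k.
  pose k0 := ex_minn exk; have [hk0 mink0] : h (Rad k0 w) (U k0 w) /\
      forall i, h (Rad i w) (U i w) -> (k0 <= i)%N.
    by rewrite /k0; case: ex_minnP.
  exists k0 => //; split => /=.
    apply: le_trans Sk; rewrite /arrival /sum_wait.
    rewrite -!(big_mkord xpredT (fun i => E i w)).
    rewrite (@big_cat_nat _ _ _ k0.+1 0 k.+1)//=; last by rewrite ltnS mink0.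
    rewrite lerDl sumr_ge0// => i _; rewrite leNgt; apply/negP => Ei.
    by apply: noN; exists i.
  move=> i /=; rewrite /first_hit ltnS => ik; case: eqP => [->//|/eqP ik0].
  by apply/negP => /mink0; apply/negP; rewrite -ltnNge ltn_neqAle ik0.
have PV : P (~` vacant_event h s) = (1 - expR (- (s * q)))%:E.
  apply/eqP; rewrite -PUA eq_le; apply/andP; split; last first.
    apply: le_measure => //; rewrite inE; first exact: bigcup_measurable.
    exact: measurableC.
  have mN : measurable (\bigcup_k [set w | E k w < 0]).
    apply: bigcup_measurable => k _.
    rewrite (_ : [set _ | _] = setT `&` E k @^-1` `]-oo, 0[).
      by case: hm => _ [_ [mE _]]; apply: mE => //; exact: measurable_itv.
    by rewrite setTI; apply/seteqP; split => w /=; rewrite in_itv.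
  have mU : measurable (\bigcup_k A k) by exact: bigcup_measurable.
  apply: (@le_trans _ _ (P (\bigcup_k A k `|` \bigcup_k [set w | E k w < 0]))).
    by apply: le_measure => //; rewrite inE; [exact: measurableC|exact: measurableU].
  rewrite -[leRHS]adde0 -negative_wait_prob0; exact: measureU2.
rewrite -[vacant_event h s]setCK probability_setC ?PV; last exact: measurableC.
by rewrite -EFinB subKr.
Unshelve. all: by end_near. Qed.

End Vacancy.

(** * Counting the arcs through one or two points *)

(** Membership is tested on the offset of [x] from [u] modulo [n]. Adding [n - u %% n] keeps the
    natural subtraction exact, even for a start [u] outside the torus. *)
Definition in_arc n u r x : bool := (x < n)%N && ((x + (n - u %% n)) %% n < r)%N.

Definition hits n (Z : {set 'I_n}) (r u : nat) := [exists x in Z, in_arc n u r x].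

Lemma in_arcP n u r x : (0 < n)%N -> Defs.arc n u r x <-> in_arc n u r x.
Proof.
move=> n0; have un : (u %% n < n)%N by rewrite ltn_mod.
have uE := divn_eq u n.
split=> [[xn [i ir xE]]|/andP[xn xr]].
  rewrite /in_arc xn /=; apply: leq_ltn_trans ir.
  rewrite xE modnDml {1}uE.
  have -> : (u %/ n * n + u %% n + i + (n - u %% n) = i + (u %/ n).+1 * n)%N by lia.
  by rewrite addnC modnMDl leq_mod.
split=> //; exists ((x + (n - u %% n)) %% n)%N => //.
rewrite modnDmr {1}uE.
have -> : (u %/ n * n + u %% n + (x + (n - u %% n)) = x + (u %/ n).+1 * n)%N by lia.
by rewrite addnC modnMDl modn_small.
Qed.

Lemma in_arc_min n u r x : (0 < n)%N -> in_arc n u (minn r n) x = in_arc n u r x.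
Proof. by move=> n0; rewrite /in_arc leq_min ltn_mod n0 andbT. Qed.

Lemma sum_ltn r n : (\sum_(0 <= d < n) (d < r) = minn r n)%N.
Proof.
elim: n => [|n IH]; first by rewrite big_geq// minn0.
by rewrite big_nat_recr//= IH; case: (ltnP n r) => nr; lia.
Qed.

Lemma in_arc_ord m (u x : 'I_m.+1) r : in_arc m.+1 u r x = ((x - u)%R < r)%N.
Proof.
rewrite /in_arc ltn_ord (modn_small (ltn_ord u)).
by have -> : nat_of_ord (x - u)%R = ((x + (m.+1 - u)) %% m.+1)%N by rewrite /= modnDmr.
Qed.

Lemma count_arc1 n (x : 'I_n) r : (\sum_(u < n) in_arc n u r x = minn r n)%N.
Proof.
case: n x => [[]//|m] x.
(* The starts are indexed by their offset [d = x - u]. *)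
rewrite (reindex_inj (inv_inj (subKr x))) -sum_ltn big_mkord.
by apply: eq_bigr => d _; rewrite in_arc_ord subKr.
Qed.

(** The displacement from [x] to [y] in the positive direction, which is not symmetric; for distinct
    points, it and its complement to [n] are the two gaps between them. *)
Definition cdist n (x y : 'I_n) : nat := ((y + (n - x)) %% n)%N.

Lemma cdist_inj n (x : 'I_n) : injective (cdist x).
Proof.
case: n x => [[]//|m] x y z /eqP.
rewrite /cdist !addnBA ?(ltnW (ltn_ord _))// => H.
apply: val_inj => /=; have xm := ltn_ord x; have ym := ltn_ord y; have zm := ltn_ord z.
move/eqP : H; have := divn_eq (y + m.+1 - x) m.+1; have := divn_eq (z + m.+1 - x) m.+1.
have : ((y + m.+1 - x) %/ m.+1 < 2)%N by rewrite ltn_divLR//; lia.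
have : ((z + m.+1 - x) %/ m.+1 < 2)%N by rewrite ltn_divLR//; lia.
have := ltn_pmod (y + m.+1 - x) (ltn0Sn m).
case: (_ %/ _)%N => [|[|//]]; case: (_ %/ _)%N => [|[|//]]; lia.
Qed.

Lemma cdist_gt0 n (x y : 'I_n) : y != x -> (0 < cdist x y < n)%N.
Proof.
move=> yx; have n0 : (0 < n)%N by case: n x {y yx} => [[]|].
rewrite ltn_mod n0 andbT lt0n; apply: contraNneq yx => c0.
apply/eqP/(@cdist_inj _ x); rewrite c0 /cdist addnBA ?(ltnW (ltn_ord _))//.
by rewrite addKn modnn.
Qed.

(** The two points cut the torus into gaps of lengths [g] and [n - g]. From a start in a gap it
    suffices to reach the point that ends it, which [minn r] of the gap length starts achieve. *)
Lemma count_arc2 n (x y : 'I_n) r : y != x ->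
  (minn r (cdist x y) + minn r (n - cdist x y) <=
   \sum_(u < n) (in_arc n u r x || in_arc n u r y))%N.
Proof.
case: n x y => [[]//|m] x y /cdist_gt0; set g := cdist x y => /andP[g0 gm].
rewrite (reindex_inj (inv_inj (subKr x))).
rewrite (eq_bigr (fun d : 'I_m.+1 => (d < r)%N || ((d + g) %% m.+1 < r)%N : nat)); last first.
  move=> d _; rewrite !in_arc_ord subKr.
  have -> : y - (x - d) = d + (y - x) by rewrite opprB addrCA addrA.
  have -> : nat_of_ord (d + (y - x))%R = ((d + g) %% m.+1)%N.
    by rewrite /g /cdist /= !modnDmr !addnA modnDmr.
  by [].
rewrite -(big_mkord xpredT (fun d => ((d < r) || ((d + g) %% m.+1 < r))%N : nat)).
(* Offsets below [m.+1 - g] are starts whose next marked point is [x]; for the others it is [y]. *)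
rewrite (@big_cat_nat _ _ _ (m.+1 - g))//= ?leq_subr// addnC; apply: leq_add.
  rewrite -sum_ltn; apply: leq_sum => d _; by case: (_ < r)%N.
rewrite -{1}[(m.+1 - g)%N]add0n big_addn subKn ?(ltnW gm)// -sum_ltn.
rewrite big_nat_cond [leqRHS]big_nat_cond; apply: leq_sum => i /andP[/andP[_ ig] _].
rewrite -addnA subnK ?(ltnW gm)// modnDr modn_small ?(ltn_trans ig gm)//.
by case: (i < r)%N; rewrite ?orbT.
Qed.

(** * The cover probability at a fixed time *)

Section CoverProbability.
Context (R : realType) (d : measure_display) (T : measurableType d).
Variables (p : nat -> R) (n : nat) (P : probability T R).
Variables (Rad U : nat -> T -> nat) (E : nat -> T -> R).
Hypotheses (n_gt0 : (0 < n)%N) (hp : radius_law p).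
Hypothesis hm : covering_model p n P Rad U E.

(* Radii at least [n] all give the full torus, so they are lumped together. *)
Definition trunc_law (r : 'I_n.+1) : R :=
  if (r < n)%N then p r else fine (\sum_(n <= j <oo) (p j)%:E)%E.

Definition arc_types (s : R) : seq ({set 'I_n} * R) :=
  [seq ([set x : 'I_n | in_arc n i.1 i.2 x]%SET, expR (- (s * (trunc_law i.2 / n%:R))))
  | i : 'I_n * 'I_n.+1].

Let p_ge0 j : 0 <= p j. Proof. by case: hp => _ []. Qed.

Let tail_fin : (\sum_(n <= j <oo) (p j)%:E)%E \is a fin_num.
Proof.
rewrite ge0_fin_numE; last by apply: nneseries_ge0 => j _ _; rewrite lee_fin.
apply: (@le_lt_trans _ _ (\sum_(j <oo) (p j)%:E)%E).
  rewrite [leRHS](nneseries_split 0 n) ?add0n; last by move=> j _; rewrite lee_fin.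
  by rewrite leeDr// sume_ge0// => j _; rewrite lee_fin.
case: hp => _ [_ h]; rewrite (_ : (\sum_(j <oo) (p j)%:E)%E = 1%E) ?ltry//.
apply/cvg_lim => //; under eq_fun do rewrite sumEFin.
by apply: cvg_EFin; [near=> k|exact: h].
Unshelve. all: by end_near. Qed.

Lemma trunc_law_ge0 r : 0 <= trunc_law r.
Proof.
rewrite /trunc_law; case: ifP => // _; rewrite fine_ge0// nneseries_ge0// => j _ _.
by rewrite lee_fin.
Qed.

Lemma hits_min (Z : {set 'I_n}) r u : hits Z (minn r n) u = hits Z r u.
Proof.
rewrite /hits; apply: eq_existsb => x; by rewrite in_arc_min.
Qed.

Lemma arc_law_hits (Z : {set 'I_n}) : arc_law p n (hits Z) =
  (\sum_(i : 'I_n * 'I_n.+1 | hits Z i.2 i.1) trunc_law i.2 / n%:R)%:E.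
Proof.
have -> : \sum_(i : 'I_n * 'I_n.+1 | hits Z i.2 i.1) trunc_law i.2 / n%:R =
    \sum_(r < n.+1) trunc_law r * (\sum_(u < n) (hits Z r u)%:R) / n%:R.
  rewrite big_mkcond/= -(pair_bigA _ (fun (u : 'I_n) (r : 'I_n.+1) =>
     if hits Z r u then trunc_law r / n%:R else 0))/= exchange_big/=.
  apply: eq_bigr => r _; rewrite mulr_sumr mulr_suml; apply: eq_bigr => u _.
  by case: (hits Z r u); rewrite ?mulr1// mulr0 mul0r.
(* The last index [r = n] is matched with the tail of the series, where [hits] no longer depends on
   the radius. *)
rewrite big_ord_recr/= /trunc_law ltnn EFinD -sumEFin /arc_law.
rewrite (nneseries_split 0 n) ?add0n; last first.
  by move=> j _; rewrite lee_fin !mulr_ge0// ?invr_ge0// sumr_ge0.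
congr (_ + _)%E.
  rewrite big_mkord; apply: eq_bigr => r _.
  by rewrite [X in if X then _ else _](ltn_ord r).
rewrite -mulrA EFinM fineK// muleC -nneseriesZl; last by move=> j _; rewrite lee_fin.
rewrite ereal_series_cond [RHS]ereal_series_cond; apply: eq_eseriesr => j.
rewrite andbT => nj; rewrite -EFinM -mulrA mulrC; congr (_ / _ * _)%:E.
by apply: eq_bigr => u _; rewrite -(hits_min Z j) (minn_idPr nj).
Qed.

Lemma vacant_prob_types s (Z : {set 'I_n}) : vacant_prob (arc_types s) Z =
  expR (- (s * fine (arc_law p n (hits Z)))).
Proof.
rewrite arc_law_hits/= /vacant_prob /arc_types big_map big_enum/=.
rewrite mulr_sumr -sumrN [in RHS]big_mkcond/= expR_sum.
apply: eq_bigr => i _ /=; rewrite (_ : fintype.disjoint _ _ = ~~ hits Z i.2 i.1).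
  by case: (hits Z i.2 i.1); rewrite ?expR0.
rewrite /hits negb_exists disjoint_sym disjoint_subset.
apply/fintype.subsetP/fintype.forallP => [ZA x|ZA x xZ]; last first.
  by have := ZA x; rewrite !inE xZ.
by rewrite negb_and -implybE; apply/implyP => /ZA; rewrite !inE.
Qed.

Lemma absent_probs_types s : 0 <= s -> absent_probs (arc_types s).
Proof.
move=> s0; apply/allP => a /mapP[i _ ->]/=; rewrite expR_ge0/=.
by rewrite -expR0 ler_expR oppr_le0 mulr_ge0// divr_ge0// trunc_law_ge0.
Qed.

Let vacant (x : 'I_n) s := vacant_event Rad U E (fun j u => in_arc n u j x) s.

Let mixed_event (Y Z : {set 'I_n}) s :=
  [set w | (forall x, x \in Y -> ~ vacant x s w) /\ (forall x, x \in Z -> vacant x s w)].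

Let measurable_mixed Y Z s : measurable (mixed_event Y Z s).
Proof.
rewrite (_ : mixed_event Y Z s = (\bigcap_(x in [set` Y]) ~` vacant x s) `&`
  (\bigcap_(x in [set` Z]) vacant x s)).
  apply: measurableI; apply: fin_bigcap_measurable => // x _.
    by apply: measurableC; exact: (measurable_vacant_event hm).
  exact: (measurable_vacant_event hm).
by apply/seteqP; split => w.
Qed.

(** The two sides agree for empty [Y], by the vacancy probabilities, and obey the same recursion
    moving a point from [Y] to [Z]. Thus vacancy probabilities alone identify the covered set with
    the independent model. *)
Lemma mixed_event_prob Y Z s : 0 <= s ->
  P (mixed_event Y Z s) = (cover_prob (arc_types s) Y Z)%:E.
Proof.
move=> s0; have [m] := ubnP #|Y|; elim: m Y Z => // m IH Y Z Ym.
have [->|[x xY]] := set_0Vmem Y.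
  rewrite cover_prob0 vacant_prob_types.
  rewrite -(vacant_event_prob n_gt0 hp hm (hits Z) s0); congr (P _).
  apply/seteqP; split => w.
    move=> [_ vZ] k Sk; apply/negP => /existsP[x /andP[xZ xk]].
    by have /negP := vZ x xZ k Sk; apply.
  move=> vw; split => [x|x xZ k Sk]; first by rewrite inE.
  by apply/negP => xk; have /negP := vw k Sk; apply; apply/existsP; exists x; rewrite xZ.
have xY' : x \notin (Y :\ x)%SET by rewrite !inE eqxx.
have Ym' : (#|Y :\ x| < m)%N by move: Ym; rewrite (cardsD1 x) xY.
have := cover_probU1 (arc_types s) Z xY'; rewrite finset.setD1K// => /eqP.
rewrite -subr_eq => /eqP <-; rewrite EFinB -!IH//.
have -> : mixed_event (Y :\ x) Z s =
    mixed_event Y Z s `|` mixed_event (Y :\ x) (x |: Z)%SET s.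
  apply/seteqP; split => w; last first.
    by case=> -[wY wZ]; split => y; rewrite ?inE => yP;
       [apply: wY|apply: wZ|apply: wY|apply: wZ];
       rewrite ?inE ?yP ?orbT//; case/andP: yP.
  move=> [wY wZ]; have [vx|vx] := pselect (vacant x s w); [right|left]; split => y.
  - exact: wY.
  - by rewrite !inE => /orP[/eqP->//|]; exact: wZ.
  - by case: (eqVneq y x) => [->//|yx yY]; apply: wY; rewrite !inE yx.
  - exact: wZ.
rewrite measureU//; last 1 first.
- by rewrite -subset0 => w [[wY _] [_ wZ]]; apply: (wY x xY); apply: wZ; rewrite !inE eqxx.
by rewrite addeK// fin_num_measure.
Qed.

Let coveredE s : [set w | covered n Rad U E s w = [set x | (x < n)%N]] =
  mixed_event finset.setT finset.set0 s.
Proof.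
apply/seteqP; split => w /=.
  move=> cw; split => x; rewrite inE// => _ vx.
  have : [set x | (x < n)%N] (x : nat) by exact: ltn_ord.
  rewrite -cw => -[k /= Sk /in_arcP-/(_ n_gt0)]; exact/negP/vx.
move=> [cw _]; apply/seteqP; split => [x [k _ []]//|x /= xn].
have := cw (Ordinal xn); rewrite inE => /(_ isT) /existsNP[k /not_implyP[Sk]].
by move=> /negP/negPn xk; exists k => //; apply/in_arcP.
Qed.

Lemma measurable_covered s :
  measurable [set w | covered n Rad U E s w = [set x | (x < n)%N]].
Proof. by rewrite coveredE. Qed.

Lemma covered_prob s : 0 <= s ->
  P [set w | covered n Rad U E s w = [set x | (x < n)%N]] =
  (cover_prob (arc_types s) finset.setT finset.set0)%:E.
Proof. by move=> s0; rewrite coveredE mixed_event_prob. Qed.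

End CoverProbability.

(** * Pair correlations *)

Section TruncatedMean.
Variables (R : realType) (p : nat -> R).
Hypothesis hp : radius_law p.

(* The mean of [min R g]. *)
Definition trunc_mean g : R := fine (\sum_(j <oo) (p j * (minn j g)%:R)%:E)%E.

Let p_ge0 j : 0 <= p j. Proof. by case: hp => _ []. Qed.

Let sum_p : (\sum_(j <oo) (p j)%:E)%E = 1%E.
Proof.
case: hp => _ [_ h]; apply/cvg_lim => //; under eq_fun do rewrite sumEFin.
by apply: cvg_EFin; [near=> k|exact: h].
Unshelve. all: by end_near. Qed.

Lemma trunc_meanE g :
  (trunc_mean g)%:E = (\sum_(j <oo) (p j * (minn j g)%:R)%:E)%E.
Proof.
rewrite fineK// ge0_fin_numE; last first.
  by apply: nneseries_ge0 => j _ _; rewrite lee_fin mulr_ge0.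
apply: (@le_lt_trans _ _ (\sum_(j <oo) (g%:R%:E * (p j)%:E))%E).
  apply: lee_nneseries => j _; first by rewrite lee_fin mulr_ge0.
  by rewrite -EFinM lee_fin mulrC ler_wpM2r// ler_nat geq_minr.
by rewrite nneseriesZl ?sum_p ?mule1 ?ltry// => j _; rewrite lee_fin.
Qed.

Lemma trunc_mean_le g g' : (g <= g')%N -> trunc_mean g <= trunc_mean g'.
Proof.
move=> gg'; rewrite -lee_fin !trunc_meanE; apply: lee_nneseries => j _.
  by rewrite lee_fin mulr_ge0.
by rewrite lee_fin ler_wpM2l// ler_nat; lia.
Qed.

Lemma trunc_mean1 : trunc_mean 1 = 1.
Proof.
apply/EFin_inj; rewrite trunc_meanE -sum_p; apply: eq_eseriesr => j _.
case: j => [|j]; first by case: hp => -> _; rewrite mul0r.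
by rewrite (_ : minn j.+1 1 = 1%N) ?mulr1//; lia.
Qed.

Lemma trunc_mean_ge1 g : (0 < g)%N -> 1 <= trunc_mean g.
Proof. by move=> g0; rewrite -trunc_mean1 trunc_mean_le. Qed.

Lemma arc_law_hits1 n (x : 'I_n) :
  fine (arc_law p n (hits [set x]%SET)) = trunc_mean n / n%:R.
Proof.
have n0 : (0 < n)%N by case: n x => [[]|].
apply/EFin_inj; rewrite EFinM trunc_meanE muleC -nneseriesZl; last first.
  by move=> j _; rewrite lee_fin mulr_ge0.
rewrite fineK; last exact: (arc_law_fin n0 hp).
apply: eq_eseriesr => j _; rewrite -EFinM; congr EFin.
rewrite [RHS]mulrC -(count_arc1 x) natr_sum; congr (_ * _ / _).
apply: eq_bigr => u _; congr (nat_of_bool _)%:R; apply/existsP/idP => [[y /andP[]]|xu].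
  by rewrite !inE => /eqP->.
by exists x; rewrite !inE eqxx.
Qed.

Lemma arc_law_hits2 n (x y : 'I_n) : y != x ->
  (trunc_mean (cdist x y) + trunc_mean (n - cdist x y)) / n%:R <=
  fine (arc_law p n (hits [set x; y]%SET)).
Proof.
move=> yx; have n0 : (0 < n)%N by case: n x {y yx} => [[]|].
rewrite -lee_fin fineK; last exact: (arc_law_fin n0 hp).
rewrite EFinM EFinD !trunc_meanE -nneseriesD; last 2 first.
- by move=> j _ _; rewrite lee_fin mulr_ge0.
- by move=> j _ _; rewrite lee_fin mulr_ge0.
rewrite muleC -nneseriesZl; last first.
  by move=> j _; rewrite -EFinD lee_fin addr_ge0// mulr_ge0.
apply: lee_nneseries => j _.
  by rewrite -EFinD -EFinM lee_fin mulr_ge0// ?invr_ge0// addr_ge0// mulr_ge0.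
rewrite -EFinD -EFinM lee_fin mulrC -mulrDr ler_wpM2r ?invr_ge0// ler_wpM2l//.
rewrite -natrD -natr_sum ler_nat; apply: leq_trans (count_arc2 j yx) _.
apply: leq_sum => u _; case/boolP: (_ || _) => //= xyu.
rewrite lt0b; apply/existsP; case/orP: xyu => ?; [exists x|exists y];
  by rewrite !inE eqxx ?orbT.
Qed.

(** The displacement from [x] is injective in [y], so it suffices to count the residues below [L] or
    above [n - L]. *)
Lemma count_near n (x : 'I_n) L :
  (\sum_(y < n) ((cdist x y < L) || (n - L < cdist x y)) <= L.*2)%N.
Proof.
have n0 : (0 < n)%N by case: n x => [[]|].
have clt y : (cdist x y < n)%N by rewrite ltn_mod.
have cinj : injective (fun y => Ordinal (clt y)).
  by move=> y z /(congr1 val); exact: cdist_inj.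
have -> : (\sum_(y < n) ((cdist x y < L) || (n - L < cdist x y)) =
    \sum_(d < n) ((d < L) || (n - L < d)))%N.
  by rewrite [RHS](reindex_inj cinj).
rewrite -(big_mkord xpredT (fun d => ((d < L) || (n - L < d))%N : nat)).
apply: (@leq_trans (\sum_(0 <= d < n) ((d < L) + (n - L < d)))%N).
  by apply: leq_sum => d _; do 2 case: (_ < _)%N.
rewrite big_split/= sum_ltn -addnn leq_add ?geq_minl//.
rewrite big_nat_rev/= add0n big_nat.
apply: (@leq_trans (\sum_(0 <= d < n) (d < L))%N); last by rewrite sum_ltn geq_minl.
rewrite [leqRHS]big_nat; apply: leq_sum => d /andP[_ dn].
by case: ltnP => //; case: ltnP => //=; lia.
Qed.

(** The first term bounds the covariance over all pairs as if both gaps were at least [L]. The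
    second pays for the at most [L.*2 * n] closer pairs, one gap being at least [n./2] and the other
    at least 1. *)
Definition cover_error n L (a : R) : R :=
  n%:R ^+ 2 * (expR (- (2 * a * trunc_mean L)) - expR (- (2 * a * trunc_mean n)))
  + L.*2%:R * n%:R * expR (- (a * (1 + trunc_mean n./2))).

Lemma cover_prob_estimate n L (a : R) : (1 < n)%N -> (L <= n)%N -> 0 <= a ->
  `|cover_prob (arc_types p n (n%:R * a)) finset.setT finset.set0
    - (1 - expR (- (a * trunc_mean n))) ^+ n| <= cover_error n L a.
Proof.
move=> n1 Ln a0; have n0 : (0 < n)%N by lia.
have nR : n%:R != 0 :> R by rewrite pnatr_eq0; lia.
pose G := expR (- (2 * a * trunc_mean L)) - expR (- (2 * a * trunc_mean n)).
pose B := expR (- (a * (1 + trunc_mean n./2))).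
have B0 : 0 <= B by exact: expR_ge0.
have G0 : 0 <= G.
  rewrite subr_ge0 ler_expR lerN2 ler_wpM2l ?trunc_mean_le//.
  by rewrite mulr_ge0.
pose near (x y : 'I_n) := ((cdist x y < L) || (n - L < cdist x y))%N.
pose b (x y : 'I_n) := G + (near x y)%:R * B.
have vE x : vacant_prob (arc_types p n (n%:R * a)) [set x]%SET =
    expR (- (a * trunc_mean n)).
  rewrite (vacant_prob_types n0 hp) arc_law_hits1; congr (expR (- _)).
  by field.
have := @cover_prob_near_product R 'I_n (arc_types p n (n%:R * a))
  (expR (- (a * trunc_mean n))) b.
have l01 : absent_probs (arc_types p n (n%:R * a)).
  by apply: absent_probs_types => //; rewrite mulr_ge0.
move=> /(_ l01 vE).
have hn0 : 0 <= trunc_mean n by rewrite (le_trans ler01)// trunc_mean_ge1.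
have v1 : expR (- (a * trunc_mean n)) <= 1.
  by rewrite -expR0 ler_expR oppr_le0 mulr_ge0.
have b0 x y : 0 <= b x y by rewrite addr_ge0// mulr_ge0.
move=> /(_ v1 _ b0); rewrite card_ord => H; apply: le_trans (H _) _ => {H}.
  move=> x y xy; rewrite (vacant_prob_types n0 hp).
  have yx : y != x by rewrite eq_sym.
  have /andP[g0 gn] := cdist_gt0 yx; set g := cdist x y in g0 gn.
  have Hle : expR (- (n%:R * a * fine (arc_law p n (hits [set x; y]%SET)))) <=
      expR (- (a * (trunc_mean g + trunc_mean (n - g)))).
    rewrite ler_expR lerN2 [n%:R * a]mulrC -mulrA ler_wpM2l//.
    by have := arc_law_hits2 yx; rewrite ler_pdivrMr ?ltr0n// mulrC.
  have v2 : expR (- (a * trunc_mean n)) ^+ 2 = expR (- (2 * a * trunc_mean n)).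
    by rewrite -expRM_natl; congr expR; ring.
  rewrite /b /near -/g v2; case: (boolP (_ || _)) => [ng|].
    have : expR (- (a * (trunc_mean g + trunc_mean (n - g)))) <= B.
      rewrite ler_expR lerN2 ler_wpM2l//.
      (* One of the two gaps is at least [n./2]; the other is positive and contributes at least
         1. *)
      have [gh|gh] := leqP n./2 g.
        by rewrite addrC lerD ?trunc_mean_le// trunc_mean_ge1// subn_gt0.
      by rewrite lerD ?trunc_mean_ge1// trunc_mean_le//; lia.
    by have := expR_ge0 (- (2 * a * trunc_mean n)); rewrite mul1r; lra.
  rewrite negb_or -!leqNgt => /andP[Lg gL]; rewrite mul0r addr0 lerB//.
  apply: le_trans Hle _; rewrite ler_expR lerN2.
  have := trunc_mean_le Lg; have /trunc_mean_le : (L <= n - g)%N by lia.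
  nra.
have sumb x : \sum_(y | y != x) b x y <= n%:R * G + L.*2%:R * B.
  apply: (@le_trans _ _ (\sum_y b x y)).
    rewrite [leLHS]big_mkcond; apply: ler_sum => y _; by case: ifP.
  rewrite big_split/= sumr_const card_ord -[G *+ n]mulr_natl lerD2l -mulr_suml.
  by rewrite ler_wpM2r// -natr_sum ler_nat count_near.
apply: (@le_trans _ _ (\sum_(x < n) (n%:R * G + L.*2%:R * B))).
  by apply: ler_sum => x _; exact: sumb.
rewrite sumr_const card_ord -[_ *+ n]mulr_natl /cover_error -/G -/B.
by rewrite le_eqVlt; apply/orP; left; apply/eqP; ring.
Qed.

End TruncatedMean.

(** * Asymptotics *)

Section Asymptotics.
Variables (R : realType) (p : nat -> R).
Hypotheses (hp : radius_law p) (hmom : moment_1eps p).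

Let p_ge0 j : 0 <= p j. Proof. by case: hp => _ []. Qed.

(* For [j > g], [j <= j^(1 + eps) * g^-eps]. *)
Lemma mean_tail : exists2 eps : R, 0 < eps & exists2 C : R, 0 <= C &
  forall g, (0 < g)%N ->
  0 <= mean_radius p - trunc_mean p g <= C * expR (- (eps * ln g%:R)).
Proof.
case: hmom => eps eps0 cM; exists eps => //.
pose v j := p j * (j%:R `^ (1 + eps)).
have v0 j : 0 <= v j by rewrite mulr_ge0// powR_ge0.
have vE j : v j.+1 = p j.+1 * expR ((1 + eps) * ln j.+1%:R).
  by rewrite /v /powR pnatr_eq0.
have le_v j : p j * j%:R <= v j.
  case: j => [|j]; first by rewrite mulr0.
  rewrite vE ler_wpM2l// -{1}(@lnK R j.+1%:R) ?posrE ?ltr0n// ler_expR.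
  by rewrite ler_peMl ?ln_ge0 ?ler1n// lerDl ltW.
have cm : cvgn (series (fun j => p j * j%:R)).
  by apply: (series_le_cvg _ v0 le_v cM) => j; rewrite mulr_ge0.
have muE : (mean_radius p)%:E = (\sum_(j <oo) (p j * j%:R)%:E)%E.
  apply/esym/cvg_lim => //; under eq_fun do rewrite sumEFin.
  by apply: cvg_EFin; [near=> k|exact: cm].
have ME : (limn (series v))%:E = (\sum_(j <oo) (v j)%:E)%E.
  apply/esym/cvg_lim => //; under eq_fun do rewrite sumEFin.
  by apply: cvg_EFin; [near=> k|exact: cM].
(* The constant is the moment of order [1 + eps]. *)
exists (limn (series v)).
  by rewrite -lee_fin ME nneseries_ge0// => j _ _; rewrite lee_fin.
move=> g g0; set c := expR _.
pose u j := p j * (j - minn j g)%:R.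
have u0 j : 0 <= u j by rewrite mulr_ge0.
have tailE : ((mean_radius p)%:E = (trunc_mean p g)%:E + \sum_(j <oo) (u j)%:E)%E.
  rewrite muE trunc_meanE// -nneseriesD.
  - apply: eq_eseriesr => j _; rewrite -EFinD -mulrDr -natrD subnKC//; exact: geq_minl.
  - by move=> j _ _; rewrite lee_fin mulr_ge0.
  - by move=> j _ _; rewrite lee_fin.
have le_u : (\sum_(j <oo) (u j)%:E <= (c * limn (series v))%:E)%E.
  rewrite EFinM ME -nneseriesZl; last by move=> j _; rewrite lee_fin.
  apply: lee_nneseries => j _; first by rewrite lee_fin.
  rewrite -EFinM lee_fin; have [jg|gj] := leqP j g.
    by rewrite /u (minn_idPl jg) subnn mulr0 mulr_ge0// expR_ge0.
  have j0 : (0 < j)%N by lia.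
  rewrite /u -(prednK j0) vE (prednK j0) mulrCA ler_wpM2l//.
  apply: (@le_trans _ _ j%:R); first by rewrite ler_nat leq_subr.
  rewrite -{1}(@lnK R j%:R) ?posrE ?ltr0n// -expRD ler_expR.
  have : ln g%:R <= ln j%:R :> R by rewrite ler_ln ?posrE ?ltr0n// ler_nat ltnW.
  nra.
have uE : (\sum_(j <oo) (u j)%:E)%E = (mean_radius p - trunc_mean p g)%:E.
  by rewrite EFinB tailE addeAC subee// add0e.
apply/andP; split; last by rewrite mulrC -lee_fin -uE.
by rewrite -lee_fin -uE nneseries_ge0// => j _ _; rewrite lee_fin.
Unshelve. all: by end_near. Qed.

Lemma mean_ge1 : 1 <= mean_radius p.
Proof.
have [eps _ [C _ /(_ 1 isT)/andP[+ _]]] := mean_tail.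
by rewrite trunc_mean1// subr_ge0.
Qed.

Let mu := mean_radius p.

Let mu_gt0 : 0 < mu. Proof. exact: lt_le_trans ltr01 mean_ge1. Qed.

Lemma near_ln_ge (A : R) : \forall n \near \oo, A <= ln (n%:R : R).
Proof.
near=> n; have nA : expR A <= n%:R by near: n; exact: nbhs_infty_ger.
by rewrite -[A]expRK ler_ln ?posrE ?expR_gt0// (lt_le_trans (expR_gt0 A)).
Unshelve. all: by end_near. Qed.

Lemma cvg_expR_ln (k : R) : 0 < k ->
  expR (- (k * ln n%:R)) @[n --> \oo] --> (0 : R).
Proof.
move=> k0; have : k * ln (n%:R : R) @[n --> \oo] --> +oo.
  apply/cvgryPge => A; near=> n; rewrite mulrC -ler_pdivrMr//.
  by near: n; exact: near_ln_ge.
by move=> h; exact: (cvg_comp _ _ h (@cvgr_expR R)).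
Unshelve. all: by end_near. Qed.

(** Half of the exponential absorbs the logarithm, by [1 + x <= expR x]; the other half still tends
    to 0. *)
Lemma cvg_lnD_expR_ln (k b : R) : 0 < k ->
  (ln n%:R + b) * expR (- (k * ln n%:R)) @[n --> \oo] --> (0 : R).
Proof.
move=> k0; have k2 : 0 < k / 2 by rewrite divr_gt0.
have h : (2 / k + `|b|) * expR (- (k / 2 * ln n%:R)) @[n --> \oo] --> (0 : R).
  by rewrite -[X in _ --> X](mulr0 (2 / k + `|b|)); apply: cvgM;
    [exact: cvg_cst|exact: cvg_expR_ln].
apply: norm_cvg0; apply: squeeze_cvgr (cvg_cst 0) h.
near=> n; have x0 : 0 <= ln (n%:R : R) by near: n; exact: near_ln_ge.
set x := ln _ in x0 *.
rewrite normr_ge0 normrM (ger0_norm (expR_ge0 _)).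
have -> : - (k * x) = - (k / 2 * x) + - (k / 2 * x) by field.
rewrite expRD mulrA ler_wpM2r ?expR_ge0//.
have xb : `|x + b| <= x + `|b| by rewrite (le_trans (ler_normD _ _))// (ger0_norm x0).
apply: le_trans (ler_wpM2r (expR_ge0 _) xb) _; rewrite mulrDl lerD//.
  rewrite expRN ler_pdivrMr ?expR_gt0//.
  have k2' : 0 < 2 / k by rewrite divr_gt0.
  have := expR_ge1Dx (k / 2 * x); rewrite -(ler_pM2l k2').
  apply: le_trans; rewrite mulrDr mulr1 mulrA.
  rewrite (_ : 2 / k * (k / 2) = 1); last by field; rewrite gt_eqF.
  by rewrite mul1r lerDr divr_ge0// ltW.
by rewrite ler_piMr// -[X in _ <= X]expR0 ler_expR oppr_le0 mulr_ge0// ltW.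
Unshelve. all: by end_near. Qed.

Variable t : R.

(** Time per site: the process is observed at time [n%:R * cover_rate n]. *)
Definition cover_rate n : R := (ln n%:R + t) / mu.

Lemma near_cover_rate_ge0 : \forall n \near \oo, 0 <= cover_rate n.
Proof.
near=> n; rewrite divr_ge0// ?(ltW mu_gt0)// -lerBlDr sub0r.
by near: n; exact: near_ln_ge.
Unshelve. all: by end_near. Qed.

Section PolynomialWindow.
Variables (m : nat -> nat) (c delta : R).
Hypotheses (c0 : 0 < c) (delta0 : 0 < delta).
Hypothesis m_ge : \forall n \near \oo, c * expR (delta * ln n%:R) <= (m n)%:R.

(** Since [m n] is at least of order [n^delta], [mean_tail] makes the defect of the mean of order
    [n^(- eps * delta)], which beats the logarithmic growth of [cover_rate]. *)
Lemma cvg_rate_defect :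
  cover_rate n * (mu - trunc_mean p (m n)) @[n --> \oo] --> (0 : R).
Proof.
have [eps eps0 [C C0 tail]] := mean_tail.
pose K := C * expR (- (eps * ln c)) / mu.
have h : K * ((ln n%:R + t) * expR (- (eps * delta * ln n%:R))) @[n --> \oo] --> (0 : R).
  rewrite -[X in _ --> X](mulr0 K); apply: cvgM; first exact: cvg_cst.
  by apply: cvg_lnD_expR_ln; rewrite mulr_gt0.
apply: squeeze_cvgr (cvg_cst 0) h.
near=> n.
have mn : c * expR (delta * ln n%:R) <= (m n)%:R by near: n.
have r0 : 0 <= cover_rate n by near: n; exact: near_cover_rate_ge0.
have m0 : (0 < m n)%N.
  by rewrite -(ltr0n R) (lt_le_trans _ mn)// mulr_gt0// expR_gt0.
have /andP[d0 d1] := tail _ m0.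
rewrite mulr_ge0//=.
apply: (@le_trans _ _ (cover_rate n * (C * expR (- (eps * (ln c + delta * ln n%:R)))))).
  rewrite ler_wpM2l// (le_trans d1)// ler_wpM2l// ler_expR lerN2 ler_wpM2l ?(ltW eps0)//.
  rewrite -[delta * _]expRK -lnM ?posrE ?expR_gt0//.
  by rewrite ler_ln ?posrE ?mulr_gt0 ?expR_gt0// ltr0n.
rewrite le_eqVlt; apply/orP; left; apply/eqP.
rewrite mulrDr opprD expRD /K /cover_rate mulrA -(mulrA eps delta).
by field; rewrite gt_eqF.
Unshelve. all: by end_near. Qed.

(** With [mu] in place of the truncated mean the expression would equal [expR (- t)] exactly; the
    discrepancy in the exponent is the vanishing defect above. *)
Lemma cvg_scaled_vacancy :
  n%:R * expR (- (cover_rate n * trunc_mean p (m n))) @[n --> \oo] --> expR (- t).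
Proof.
have h : expR (- t + cover_rate n * (mu - trunc_mean p (m n))) @[n --> \oo] --> expR (- t).
  apply: continuous_cvg; first exact: continuous_expR.
  rewrite -[X in _ --> X]addr0; apply: cvgD; first exact: cvg_cst.
  exact: cvg_rate_defect.
apply: cvg_trans h; apply: near_eq_cvg; near=> n.
have n0 : (0 < n)%N by near: n; exact: nbhs_infty_gt.
rewrite -[in RHS](@lnK R n%:R) ?posrE ?ltr0n// -expRD; congr expR.
by rewrite /cover_rate; field; rewrite gt_eqF.
Unshelve. all: by end_near. Qed.

End PolynomialWindow.

Lemma cvg_window_full :
  n%:R * expR (- (cover_rate n * trunc_mean p n)) @[n --> \oo] --> expR (- t).
Proof.
apply: (@cvg_scaled_vacancy id 1 1) => //.
near=> n; have n0 : (0 < n)%N by near: n; exact: nbhs_infty_gt.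
by rewrite !mul1r lnK// posrE ltr0n.
Unshelve. all: by end_near. Qed.

Lemma cvg_window_half :
  n%:R * expR (- (cover_rate n * trunc_mean p n./2)) @[n --> \oo] --> expR (- t).
Proof.
(* The constant 1/4 absorbs the rounding: [n <= 4 * n./2] once [n > 1]. *)
apply: (@cvg_scaled_vacancy (fun n => n./2) (1 / 4) 1) => //.
near=> n; have n1 : (1 < n)%N by near: n; exact: nbhs_infty_gt.
rewrite [1 * ln _]mul1r lnK ?posrE ?ltr0n ?(ltnW n1)// mul1r ler_pdivrMl// -natrM ler_nat.
by lia.
Unshelve. all: by end_near. Qed.

(** Half of the exponent in [expR (- cover_rate n)], which is of order [n^(- 1 / mu)]: multiplied by
    [n^delta], it still decays like [n^(- delta)]. *)
Let delta := (2 * mu)^-1.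

Let delta_gt0 : 0 < delta. Proof. by rewrite invr_gt0 mulr_gt0. Qed.

Definition cutoff n := Num.trunc (expR (delta * ln (n%:R : R))).

Let cutoff_le n : (cutoff n)%:R <= expR (delta * ln (n%:R : R)).
Proof. by have /andP[] := truncn_itv (expR_ge0 (delta * ln (n%:R : R))). Qed.

Lemma cvg_window_cutoff :
  n%:R * expR (- (cover_rate n * trunc_mean p (cutoff n))) @[n --> \oo] --> expR (- t).
Proof.
(* The integer part of a real [x >= 1] is at least [x / 2]. *)
apply: (@cvg_scaled_vacancy cutoff (1 / 2) delta) => //.
near=> n; have n0 : (0 < n)%N by near: n; exact: nbhs_infty_gt.
set x := expR _; have x1 : 1 <= x.
  by rewrite -[X in X <= _]expR0 ler_expR mulr_ge0 ?(ltW delta_gt0)// ln_ge0// ler1n.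
have /andP[_ xlt] := truncn_itv (le_trans ler01 x1).
have : (1 <= Num.trunc x)%N by rewrite truncn_gt0.
rewrite -(ler_nat R) => k1; rewrite /cutoff -/x.
move: xlt; rewrite -natr1; lra.
Unshelve. all: by end_near. Qed.

(** The far term is a difference of squares with the common limit [expR (- t) ^+ 2]. In the near
    term, the half window contributes a bounded factor and [(cutoff n)%:R * expR (- cover_rate n)]
    tends to 0. *)
Lemma cvg_cover_error :
  cover_error p n (cutoff n) (cover_rate n) @[n --> \oo] --> (0 : R).
Proof.
pose w m n := n%:R * expR (- (cover_rate n * trunc_mean p m)).
have e2 x y : expR (- (2 * x * y)) = expR (- (x * y)) ^+ 2.
  by rewrite -expRM_natl; congr expR; ring.
rewrite (_ : (fun n => _) = fun n => w (cutoff n) n ^+ 2 - w n n ^+ 2 +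
  2 * ((cutoff n)%:R * expR (- cover_rate n)) * w n./2 n); last first.
  apply/funext => n; rewrite /cover_error /w !e2 [cover_rate n * (1 + _)]mulrDr.
  rewrite mulr1 opprD expRD -mul2n natrM.
  by ring.
have -> : (0 : R) = expR (- t) ^+ 2 - expR (- t) ^+ 2 + 2 * 0 * expR (- t) by ring.
apply: cvgD; first apply: cvgB.
- rewrite expr2; apply: cvgM; exact: cvg_window_cutoff.
- rewrite expr2; apply: cvgM; exact: cvg_window_full.
apply: cvgM; last exact: cvg_window_half.
apply: cvgM; first exact: cvg_cst.
have h : expR (- (t / mu)) * expR (- (delta * ln n%:R)) @[n --> \oo] --> (0 : R).
  rewrite -[X in _ --> X](mulr0 (expR (- (t / mu)))); apply: cvgM; first exact: cvg_cst.
  exact: cvg_expR_ln.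
apply: squeeze_cvgr (cvg_cst 0) h; near=> n.
rewrite mulr_ge0 ?expR_ge0//=.
apply: le_trans (ler_wpM2r (expR_ge0 _) (cutoff_le n)) _.
rewrite -!expRD ler_expR le_eqVlt; apply/orP; left; apply/eqP.
by rewrite /cover_rate /delta; field; rewrite gt_eqF.
Unshelve. all: by end_near. Qed.

(** For [0 <= v < 1], [1 - v] lies between [expR (- (v / (1 - v)))] and [expR (- v)], both by
    [1 + x <= expR x]; the [n]-th powers of the bounds have the same limit. *)
Lemma cvg_vacancy_power :
  (1 - expR (- (cover_rate n * trunc_mean p n))) ^+ n @[n --> \oo] -->
  expR (- expR (- t)).
Proof.
pose v n := expR (- (cover_rate n * trunc_mean p n)).
have v0 : v n @[n --> \oo] --> (0 : R).
  have h : n%:R * v n * expR (- (1 * ln n%:R)) @[n --> \oo] --> (0 : R).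
    rewrite -[X in _ --> X](mulr0 (expR (- t))); apply: cvgM; first exact: cvg_window_full.
    exact: cvg_expR_ln.
  apply: cvg_trans h; apply: near_eq_cvg; near=> n.
  have n0 : (0 < n)%N by near: n; exact: nbhs_infty_gt.
  rewrite mul1r expRN lnK ?posrE ?ltr0n// mulrAC divff ?mul1r//.
  by rewrite pnatr_eq0 -lt0n.
have hi : expR (- (n%:R * v n)) @[n --> \oo] --> expR (- expR (- t)).
  apply: continuous_cvg; first exact: continuous_expR.
  by apply: cvgN; exact: cvg_window_full.
have lo : expR (- (n%:R * v n / (1 - v n))) @[n --> \oo] --> expR (- expR (- t)).
  apply: continuous_cvg; first exact: continuous_expR.
  rewrite -[X in - X](divr1 (expR (- t))); apply: cvgN; apply: cvgM.
    exact: cvg_window_full.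
  apply: cvgV; first by rewrite oner_neq0.
  by rewrite -[X in _ --> X]subr0; apply: cvgB; [exact: cvg_cst|exact: v0].
apply: squeeze_cvgr lo hi; near=> n.
have v1 : v n < 1.
  near: n; exact: (cvgr_lt _ v0).
have v1' : 0 < 1 - v n by rewrite subr_gt0.
rewrite -/(v n); apply/andP; split.
  rewrite -mulrA -mulrN expRM_natl lerXn2r ?nnegrE ?expR_ge0 ?(ltW v1')//.
  rewrite -[leRHS]invrK expRN lef_pV2 ?posrE ?expR_gt0 ?invr_gt0//.
  apply: le_trans (expR_ge1Dx _); rewrite le_eqVlt; apply/orP; left; apply/eqP.
  by field; rewrite gt_eqF.
rewrite -mulrN expRM_natl lerXn2r ?nnegrE ?expR_ge0 ?(ltW v1')//.
exact: expR_ge1Dx.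
Unshelve. all: by end_near. Qed.

Lemma cvg_cover_prob :
  cover_prob (arc_types p n (n%:R * cover_rate n)) finset.setT finset.set0
  @[n --> \oo] --> expR (- expR (- t)).
Proof.
have lo : (1 - expR (- (cover_rate n * trunc_mean p n))) ^+ n -
    cover_error p n (cutoff n) (cover_rate n) @[n --> \oo] --> expR (- expR (- t)).
  rewrite -[X in _ --> X]subr0; apply: cvgB; first exact: cvg_vacancy_power.
  exact: cvg_cover_error.
have hi : (1 - expR (- (cover_rate n * trunc_mean p n))) ^+ n +
    cover_error p n (cutoff n) (cover_rate n) @[n --> \oo] --> expR (- expR (- t)).
  rewrite -[X in _ --> X]addr0; apply: cvgD; first exact: cvg_vacancy_power.
  exact: cvg_cover_error.
apply: squeeze_cvgr lo hi; near=> n.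
have n1 : (1 < n)%N by near: n; exact: nbhs_infty_gt.
have r0 : 0 <= cover_rate n by near: n; exact: near_cover_rate_ge0.
have cn : (cutoff n <= n)%N.
  rewrite -(ler_nat R) (le_trans (cutoff_le n))//.
  rewrite -[leRHS]lnK ?posrE ?ltr0n ?(ltnW n1)// ler_expR ler_piMl//.
    by rewrite ln_ge0// ler1n ltnW.
  by rewrite invf_le1 ?mulr_gt0//; have := mean_ge1; rewrite /mu; lra.
by rewrite -ler_distl cover_prob_estimate.
Unshelve. all: by end_near. Qed.

End Asymptotics.

(** * The cover time *)

Section CoverTime.
Context (R : realType) (T : Type).
Variables (n : nat) (Rad U : nat -> T -> nat) (E : nat -> T -> R).

Let full := [set x : nat | (x < n)%N].

Lemma covered_mono s s' w : s <= s' ->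
  covered n Rad U E s w = full -> covered n Rad U E s' w = full.
Proof.
move=> ss' sw; apply/seteqP; split => [x [k _ []]//|x].
by rewrite -[X in X x -> _]sw => -[k /= Sk xk]; exists k => //=; exact: le_trans ss'.
Qed.

Lemma covered_cover_time_le s w : 0 <= s -> covered n Rad U E s w = full ->
  (cover_time n Rad U E w <= s%:E)%E.
Proof. by move=> s0 sw; apply: ereal_inf_lbound; exists s. Qed.

Lemma cover_time_le_covered s s' w : s < s' ->
  (cover_time n Rad U E w <= s%:E)%E -> covered n Rad U E s' w = full.
Proof.
move=> ss' Ts; have : (cover_time n Rad U E w < s'%:E)%E.
  by apply: le_lt_trans Ts _; rewrite lte_fin.
move=> /ereal_inf_lt[_ [r [r0 rw] <-]]; rewrite lte_fin => rs'.
exact: covered_mono (ltW rs') rw.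
Qed.

(** The infimum is at most [s] exactly when the torus is covered at times arbitrarily close above
    [s]; a countable family of such times gives measurability. *)
Lemma cover_time_leE s : 0 <= s -> [set w | (cover_time n Rad U E w <= s%:E)%E] =
  \bigcap_k [set w | covered n Rad U E (s + k.+1%:R^-1) w = full].
Proof.
move=> s0; apply/seteqP; split => w /= H.
  by move=> k _; apply: cover_time_le_covered H; rewrite ltrDl.
apply/lee_addgt0Pr => e e0; have /ltr_add_invr[k ke] : 0 < e by [].
apply: (@le_trans _ _ (s + k.+1%:R^-1)%:E).
  by apply: covered_cover_time_le; [rewrite addr_ge0|exact: H].
by rewrite -EFinD lee_fin lerD2l ltW// -[X in X < _]add0r.
Qed.

Lemma rescaled_cover_time_le (mu c t : R) w : 0 < mu -> (0 < n)%N ->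
  ((mu / n%:R)%:E * cover_time n Rad U E w - c%:E <= t%:E)%E =
  (cover_time n Rad U E w <= (n%:R * ((c + t) / mu))%:E)%E.
Proof.
move=> mu0 n0; have k0 : 0 < mu / n%:R by rewrite divr_gt0// ltr0n.
case: (cover_time _ _ _ _ w) => [r| |].
- rewrite -EFinM -EFinB !lee_fin lerBlDl -ler_pdivlMl// invf_div.
  by rewrite mulrAC -mulrA.
- by rewrite gt0_muley ?lte_fin// addye// !leye_eq.
- by rewrite gt0_muleNy ?lte_fin// addNye !leNye.
Qed.

End CoverTime.

Unset Implicit Arguments.

Theorem theoremA (R : realType) (p : nat -> R)
  (hp : radius_law p) (hmom : moment_1eps p)
  (d : nat -> measure_display) (Omega : forall n, measurableType (d n))
  (P : forall n, probability (Omega n) R)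
  (Rad U : forall n, nat -> Omega n -> nat) (E : forall n, nat -> Omega n -> R)
  (hmodel : forall n, (0 < n)%N -> covering_model p n (P n) (Rad n) (U n) (E n)) :
  forall t : R,
    (fun n : nat => P n [set w | ((mean_radius p / n%:R)%:E
                                   * cover_time n (Rad n) (U n) (E n) w
                                   - (ln n%:R)%:E <= t%:E)%E])
      @ \oo --> (expR (- expR (- t)))%:E.
Proof.
move=> t; pose A n := [set w | ((mean_radius p / n%:R)%:E
  * cover_time n (Rad n) (U n) (E n) w - (ln n%:R)%:E <= t%:E)%E].
pose G u : R := expR (- expR (- u)).
pose C n s := [set w | covered n (Rad n) (U n) (E n) s w = [set x | (x < n)%N]].
pose time u n := n%:R * cover_rate p u n.
pose F u n := cover_prob (arc_types p n (time u n)) finset.setT finset.set0.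
have mu0 : 0 < mean_radius p by exact: lt_le_trans ltr01 (mean_ge1 hp hmom).
have AE n : (0 < n)%N ->
    A n = [set w | (cover_time n (Rad n) (U n) (E n) w <= (time t n)%:E)%E].
  by move=> n0; apply/seteqP; split => w; rewrite /A/= rescaled_cover_time_le.
have mA n : (0 < n)%N -> 0 <= time t n -> measurable (A n).
  move=> n0 s0; rewrite AE// cover_time_leE//; apply: bigcap_measurableType => k _.
  exact: (measurable_covered n0 (hmodel n n0)).
(* Covered at [s] implies cover time at most [s], but the converse is only available at later times.
   Hence the law is squeezed between the cover probabilities for [t] and for any [u > t]. *)
have lower n : (0 < n)%N -> 0 <= time t n -> ((F t n)%:E <= P n (A n))%E.
  move=> n0 s0; rewrite -(covered_prob n0 hp (hmodel n n0) s0) le_measure ?inE//.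
  - exact: (measurable_covered n0 (hmodel n n0)).
  - exact: mA.
  - by rewrite AE// => w; exact: covered_cover_time_le.
have upper u n : t < u -> (0 < n)%N -> 0 <= time t n -> (P n (A n) <= (F u n)%:E)%E.
  move=> tu n0 s0; have tus : time t n < time u n.
    by rewrite ltr_pM2l ?ltr0n// ltr_pM2r ?invr_gt0// ltrD2l.
  have u0 := ltW (le_lt_trans s0 tus).
  rewrite -(covered_prob n0 hp (hmodel n n0) u0) le_measure ?inE//.
  - exact: mA.
  - exact: (measurable_covered n0 (hmodel n n0)).
  - by rewrite AE// => w; exact: cover_time_le_covered.
have time_ge0 : \forall n \near \oo, 0 <= time t n.
  near=> n; rewrite mulr_ge0//; near: n; exact: (near_cover_rate_ge0 hp hmom t).
suff h : fine (P n (A n)) @[n --> \oo] --> G t.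
  apply: cvg_EFin; last exact: h.
  near=> n; apply: fin_num_measure; apply: mA; near: n; last exact: time_ge0.
  exact: nbhs_infty_gt.
apply/cvgrPdist_le => e e0; have e2 : 0 < e / 2 by rewrite divr_gt0.
have cG : G u @[u --> t^'+] --> G t.
  apply: cvg_at_right_filter.
  apply: (@continuous_comp _ _ _ (fun v : R => - expR (- v)) expR);
    last exact: continuous_expR.
  apply: continuousN.
  apply: (@continuous_comp _ _ _ (-%R : R -> R) expR); last exact: continuous_expR.
  exact: opp_continuous.
(* Right continuity of the limit law makes the cost of passing from [t] to [u] at most [e / 2]. *)
have [u [tu Gu]] : exists u, t < u /\ `|G t - G u| <= e / 2.
  apply: (@filter_ex _ (t^'+)); near=> u; split.
    by near: u; exact: nbhs_right_gt.
  near: u; exact: (cvgrPdist_le _ _).1.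
have /cvgrPdist_le Ft := @cvg_cover_prob R p hp hmom t.
have /cvgrPdist_le Fu := @cvg_cover_prob R p hp hmom u.
near=> n.
have n0 : (0 < n)%N by near: n; exact: nbhs_infty_gt.
have s0 : 0 <= time t n by near: n; exact: time_ge0.
have Fut : `|G t - F t n| <= e by near: n; exact: (Ft e e0).
have Fuu : `|G u - F u n| <= e / 2 by near: n; exact: (Fu _ e2).
have Pf : P n (A n) \is a fin_num by apply: fin_num_measure; exact: mA.
have hl : F t n <= fine (P n (A n)) by rewrite -lee_fin fineK// lower.
have hu : fine (P n (A n)) <= F u n by rewrite -lee_fin fineK// upper.
move: Gu Fut Fuu; rewrite !ler_distl.
lra.
Unshelve. all: by end_near. Qed.
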